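(* Consider the two-states model described in the context, with $n$ users, and let $f_P$ be a continuous density for which there are $\delta_1,\delta_2>0$ with $\delta_1<f_P(p)<\delta_2$ for $p\in(0,1)$ and $f_P(p)=0$ for $p\notin(0,1)$. Suppose that the number of observations $m=m(n)$ is arbitrary, and that $R_u\sim \mathrm{Uniform}[0,a_n]$ with $a_n=c'n^{-(1-\beta)}$ for some $c'>0$ and $0<\beta<1$. Then user $1$ has perfect privacy, i.e. $$\forall k\in\mathbb{N},\qquad \lim_{n\to\infty} I\left(X_1(k);\mathbf{Y}\right)=0 .$$
   Context: Two-states model. For each $n$ there are $n$ users. (Data) Parameters $P_1,\dots,P_n$ are drawn independently from the density $f_P$. Given $P_1=p_1,\dots,P_n=p_n$, the data $X_u(k)$, $k=1,2,\dots$, of user $u$ are i.i.d. $\mathrm{Bernoulli}(p_u)$, independent across users. (Obfuscation) Independently of everything else, $R_1,\dots,R_n$ are i.i.d. $\mathrm{Uniform}[0,a_n]$, where $a_n\in(0,1]$ (consider $n$ large enough that $a_n\le 1$). Each $R_u$ is drawn once and kept fixed for all times. Given the $X$'s and $R$'s, independently over $u$ and $k$, $Z_u(k)=X_u(k)$ with probability $1-R_u$ and $Z_u(k)=1-X_u(k)$ with probability $R_u$. Let $\mathbf{Z}_u=(Z_u(1),\dots,Z_u(m))^T$, with $m=m(n)$. (Anonymization) $\Pi$ is a uniformly random permutation of $\{1,\dots,n\}$, independent of everything else, and $\mathbf{Y}=[\mathbf{Z}_{\Pi^{-1}(1)},\dots,\mathbf{Z}_{\Pi^{-1}(n)}]$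 is the $m\times n$ matrix observed by the adversary. (Adversary) The adversary knows the values of $P_1,\dots,P_n$ and $a_n$, but not $\Pi$ nor $R_1,\dots,R_n$. Accordingly, all probabilities are taken from the adversary's viewpoint, i.e. conditioned on $P_1,\dots,P_n$, so $I(X_1(k);\mathbf{Y})$ denotes the conditional mutual information $I(X_1(k);\mathbf{Y}\mid P_1,\dots,P_n)$. *)

(* Defs.v *)
From HB Require Import structures.
From mathcomp Require Import all_boot all_order all_algebra all_fingroup.
From mathcomp Require Import all_classical all_reals all_analysis.
Set Implicit Arguments.
Unset Strict Implicit.
Unset Printing Implicit Defensive.
Import Order.TTheory GRing.Theory Num.Theory.
Import numFieldNormedType.Exports.
Local Open Scope classical_set_scope.
Local Open Scope ring_scope.
Local Open Scope charge_scope.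

(** Mutual information, in nats, of a joint probability mass function [q].
    Terms with [q x y = 0] vanish, i.e. 0 log 0 = 0. *)
Definition mutual_information (R : realType) (A B : finType)
    (q : A -> B -> R) : R :=
  \sum_(x : A) \sum_(y : B)
    q x y * ln (q x y / ((\sum_(y' : B) q x y') * (\sum_(x' : A) q x' y))).

(** Kolmogorov's definition: [g] is a version of [w |-> Pr (E | W = w)]. *)
Definition is_cond_prob d d' (T : measurableType d) (U : measurableType d')
    (R : realType) (Pr : probability T R) (W : {RV Pr >-> U})
    (E : set T) (g : U -> R) : Prop :=
  (distribution Pr W).-integrable [set: U] (EFin \o g) /\
  forall B : set U, measurable B ->
    Pr (E `&` W @^-1` B) = (\int[distribution Pr W]_(w in B) (g w)%:E)%E.

(** A chosen version; versions agree almost everywhere, so integrals of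
    functions of [cond_prob] against the law of [W] do not depend on the choice.
    The default value is never used when [E] is measurable, see [cond_probP]. *)
Definition cond_prob d d' (T : measurableType d) (U : measurableType d')
    (R : realType) (Pr : probability T R) (W : {RV Pr >-> U})
    (E : set T) : U -> R :=
  xget (fun _ => 0) [set g | is_cond_prob W E g].

Lemma cond_probP d d' (T : measurableType d) (U : measurableType d')
    (R : realType) (Pr : probability T R) (W : {RV Pr >-> U}) (E : set T) :
  measurable E -> is_cond_prob W E (cond_prob W E).
Proof.
move=> mE; apply: xgetPex.
have finE : (Pr E < +oo)%E by rewrite ltey_eq fin_num_measure.
pose nu0 := pushforward (mfrestr mE finE) W.
have nu0_fin : fin_num_fun nu0.
  by move=> B mB; apply: fin_num_measure; exact: measurable_funPTI.
have mW : measurable_fun [set: T] W by [].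
pose finite_of := Measure_isFinite.Build _ _ _ nu0 nu0_fin.
pose nu_isFinite := finite_of mW.
pose nu_of : {finite_measure set U -> \bar R} := HB.pack nu0 nu_isFinite.
pose nu := nu_of mW.
have nuE B : nu B = Pr (E `&` W @^-1` B) by rewrite setIC.
have nu_ac : charge_of_finite_measure nu `<< distribution Pr W.
  apply/null_content_dominatesP => B mB PB0.
  have mWB : measurable (W @^-1` B) by exact: measurable_funPTI.
  rewrite [LHS]nuE; apply: (@subset_measure0 _ _ _ _ _ (W @^-1` B)) => //.
  exact: measurableI.
pose h := 'd (charge_of_finite_measure nu) '/d (distribution Pr W).
have hE : EFin \o (fine \o h) = h.
  by apply/funext => w; rewrite /= fineK// Radon_Nikodym_fin_num.
exists (fine \o h); split; first by rewrite hE; exact: Radon_Nikodym_integrable.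
move=> B mB; rewrite -nuE [LHS](Radon_Nikodym_integral nu_ac mB) -/h.
by rewrite -[in LHS]hE.
Qed.

(** [I(X; Y | W)]: the mutual information of the conditional joint law of
    [(X, Y)] given [W = w], averaged over the law of [W]. *)
Definition cond_mutual_information d d' (T : measurableType d)
    (U : measurableType d') (R : realType) (Pr : probability T R)
    (A B : finType) (X : T -> A) (Y : T -> B) (W : {RV Pr >-> U}) : \bar R :=
  (\int[distribution Pr W]_w
     (mutual_information
        (fun x y => cond_prob W (X @^-1` [set x] `&` Y @^-1` [set y]) w))%:E)%E.

(** The array of the first [K] samples of [n] users; rows are times. *)
Definition samples (T : Type) (n K : nat) (V : 'I_n -> nat -> T -> bool)
    (t : T) : 'M[bool]_(K, n) :=
  \matrix_(k < K, u < n) V u k t.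

(** The joint law of the parameters [P], data [X], noise levels [N],
    obfuscated data [Z] and permutation [Pi] of [n] users. Users are numbered
    from 0, and so are times: [X u k] is the [k.+1]-th sample of [u]. *)
Record two_states_model d (T : measurableType d) (R : realType)
    (Pr : probability T R) (n : nat) (f : R -> R) (a : R)
    (P : {RV Pr >-> n.-tuple R}) (X : 'I_n -> nat -> {RV Pr >-> bool})
    (N : {RV Pr >-> n.-tuple R}) (Z : 'I_n -> nat -> {RV Pr >-> bool})
    (Pi : T -> 'S_n) : Prop := TwoStatesModel {
  parameters_iid : forall C : 'I_n -> set R, (forall u, measurable (C u)) ->
    Pr [set t | forall u, C u (tnth (P t) u)] =
    (\prod_(u < n) \int[lebesgue_measure]_(p in C u) (f p)%:E)%E ;
  data_bernoulli : forall (K : nat) (x : 'M[bool]_(K, n)),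
    is_cond_prob P (samples K X @^-1` [set x])
      (fun p => \prod_(u < n) \prod_(k < K) bernoulli_pmf (tnth p u) (x k u)) ;
  noise_uniform : forall (K : nat) (x : 'M[bool]_(K, n))
      (B : set (n.-tuple R)) (C : 'I_n -> set R),
    measurable B -> (forall u, measurable (C u)) ->
    Pr (P @^-1` B `&` samples K X @^-1` [set x] `&`
        [set t | forall u, C u (tnth (N t) u)]) =
    (Pr (P @^-1` B `&` samples K X @^-1` [set x]) *
     \prod_(u < n) \int[lebesgue_measure]_(r in C u) (uniform_pdf 0 a r)%:E)%E ;
  (* [z k u (+) x k u] says that the bit is flipped *)
  obfuscation : forall (K : nat) (x z : 'M[bool]_(K, n)) (B C : set (n.-tuple R)),
    measurable B -> measurable C ->
    let E := P @^-1` B `&` samples K X @^-1` [set x] `&` N @^-1` C in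
    Pr (E `&` samples K Z @^-1` [set z]) =
    (\int[Pr]_(t in E)
       (\prod_(u < n) \prod_(k < K)
          bernoulli_pmf (tnth (N t) u) (z k u (+) x k u))%:E)%E ;
  permutation_measurable : forall s : 'S_n, measurable (Pi @^-1` [set s]) ;
  permutation_uniform : forall (K : nat) (x z : 'M[bool]_(K, n))
      (B C : set (n.-tuple R)) (s : 'S_n),
    measurable B -> measurable C ->
    let E := P @^-1` B `&` samples K X @^-1` [set x] `&` N @^-1` C
               `&` samples K Z @^-1` [set z] in
    Pr (E `&` Pi @^-1` [set s]) = (Pr E * (n`!%:R^-1)%:E)%E }.

(** Column [j] of the adversary's [m * n] observation is [Z_{Pi^-1(j)}]. *)
Definition observation (T : Type) (n m : nat) (Z : 'I_n -> nat -> T -> bool)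
    (Pi : T -> 'S_n) (t : T) : 'M[bool]_(m, n) :=
  \matrix_(k < m, j < n) Z ((Pi t)^-1%g j) k t.

Definition noise_level (R : realType) (c beta : R) (n : nat) : R :=
  c * n%:R `^ (- (1 - beta)).

(* Main.v *)
Require Import Defs.
From HB Require Import structures.
From mathcomp Require Import all_boot all_order all_algebra all_fingroup.
From mathcomp Require Import all_classical all_reals all_analysis.
From mathcomp Require Import measurable_realfun measurable_fun_approximation.
From mathcomp Require Import finmap ring lra.
Import Order.TTheory GRing.Theory Num.Theory.
Import numFieldNormedType.Exports.
Set Implicit Arguments.
Unset Strict Implicit.
Unset Printing Implicit Defensive.
Local Open Scope classical_set_scope.
Local Open Scope ring_scope.

(** Everything is conditional on the parameters [p]. The mutual information of a
    bit of user 1 and of the observation is controlled by the L1 distance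
    [sum_y |Pr(X = 1, Y = y) - p_1 Pr(Y = y)|]. The obfuscated data of user [u]
    are Bernoulli of parameter [p_u + (1 - 2 p_u) r], with [r] uniform on [0, a],
    so a column of a user with [|p_u - p_1| <= eps a] is distributed like a
    column of user 1 up to an error [O(eps / |1 - 2 p_1|)] in total variation;
    besides, a bit and its obfuscation differ with probability at most [a]. Up to
    these errors, the columns of [L + 1] such users, user 1 included, are
    exchangeable, and the anonymization replaces [Z_1(k) - p_1] by its average
    over these users, whose second moment is at most [1 / (L + 1) + a^2].

    Here [L] is fixed while [n -> oo]. To find the users close to user 1, the
    unit interval is cut into about [1 / (eps a)] cells, and the other users into
    [L] blocks of about [n / L] users. A given block misses the cell of user 1
    with probability at most about [1 / (n a eps / L)], which tends to 0 since
    [n a] is of order [n ^ beta]. *)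

(** * Mutual information and random permutations *)

(** As [m] is arbitrary, no estimate may depend on the length of a column, although Bernoulli
    columns with two distinct parameters become mutually singular as they grow. What saves the
    comparison is that the level [r] is common to the whole column: the output of user [u] is a
    mixture of Bernoulli columns over an interval of length [|1 - 2 p_u| a], and moving the ends of
    that interval costs a multiple of the displacement divided by the length, for every [m]. The
    scale [eps a] of closeness and the exclusion of parameters near 1/2 both come from there.
    Parameters near 0 and 1 are excluded because passing from the L1 distance to the mutual
    information divides by the smaller probability of the bit. On the excluded set the mutual
    information is only bounded by 1, so the probability of that set has to be small. Probabilities
    of columns are handled as polynomials in the Bernoulli parameter, which turns averaging over [r]
    into algebra. *)

Lemma sum_ffun_prod (R : comNzRingType) (I A : finType) (F : I -> A -> R) :
  \sum_(z : {ffun I -> A}) \prod_i F i (z i) = \prod_i \sum_a F i a.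
Proof. by rewrite bigA_distr_bigA. Qed.

(** Hybrid argument: [mix s] has the factors indexed by [s] already replaced, and replacing one more
    costs the L1 distance of that factor alone, since the others have L1 norm at most 1. The factors
    may be signed, as [signal] will be. *)
Lemma sum_prod_dist (R : realType) (I A : finType) (F G : I -> A -> R) :
  (forall i, \sum_a `|F i a| <= 1) -> (forall i, \sum_a `|G i a| <= 1) ->
  \sum_(z : {ffun I -> A}) `|\prod_i F i (z i) - \prod_i G i (z i)| <=
  \sum_i \sum_a `|F i a - G i a|.
Proof.
move=> F1 G1.
pose mix (s : seq I) (i : I) a := if i \in s then G i a else F i a.
have mix1 s i : \sum_a `|mix s i a| <= 1.
  by rewrite /mix; case: (i \in s).
suff H (s : seq I) : uniq s ->
    \sum_(z : {ffun I -> A}) `|\prod_i F i (z i) - \prod_i mix s i (z i)| <=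
    \sum_(i <- s) \sum_a `|F i a - G i a|.
  have := H (enum I) (enum_uniq _); rewrite big_enum /=.
  congr (_ <= _); apply: eq_bigr => z _; congr (`|_ - _|).
  by apply: eq_bigr => i _; rewrite /mix mem_enum.
elim: s => [_|j s IH /= /andP[js us]].
  rewrite big_nil big1// => z _.
  by rewrite (_ : \prod_i mix [::] i (z i) = \prod_i F i (z i)) ?subrr ?normr0.
rewrite big_cons addrC.
apply: le_trans (_ : \sum_(z : {ffun I -> A})
   (`|\prod_i F i (z i) - \prod_i mix s i (z i)| +
    `|\prod_i mix s i (z i) - \prod_i mix (j :: s) i (z i)|) <= _).
  by apply: ler_sum => z _; exact: ler_distD.
rewrite big_split/= lerD ?IH//.
pose h i a := if i == j then F j a - G j a else mix s i a.
have hE (z : {ffun I -> A}) :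
    \prod_i mix s i (z i) - \prod_i mix (j :: s) i (z i) = \prod_i h i (z i).
  rewrite (bigD1 j)//= [X in _ - X](bigD1 j)//= [RHS](bigD1 j)//=.
  have -> : \prod_(i | i != j) mix (j :: s) i (z i) =
            \prod_(i | i != j) mix s i (z i).
    by apply: eq_bigr => i ij; rewrite /mix in_cons (negbTE ij).
  have -> : \prod_(i | i != j) h i (z i) = \prod_(i | i != j) mix s i (z i).
    by apply: eq_bigr => i ij; rewrite /h (negbTE ij).
  by rewrite /h eqxx -mulrBl /mix (negbTE js) in_cons eqxx.
under eq_bigr do rewrite hE normr_prod.
rewrite (sum_ffun_prod (fun i a => `|h i a|)) (bigD1 j)//= {1}/h eqxx.
rewrite -[leRHS]mulr1 ler_wpM2l ?sumr_ge0// prodr_ile1// => i ij.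
by rewrite sumr_ge0//= /h (negbTE ij) mix1.
Qed.

Lemma ln_le_subr1 (R : realType) (x : R) : 0 < x -> ln x <= x - 1.
Proof. by move=> x0; rewrite -{1}(subrKC 1 x) le_ln1Dx// ltrBrDl subrr. Qed.

(** The inequality [ln t <= t - 1] gives the upper bound when applied to [q / (qA qB)] and the lower
    one when applied to its inverse. In the former, [q <= qB] leaves at most 1 for each letter [x],
    hence a total of 1 for a bit. *)
Lemma mutual_information_bounds (R : realType) (A B : finType) (q : A -> B -> R) :
  (forall x y, 0 <= q x y) -> \sum_x \sum_y q x y = 1 ->
  0 <= mutual_information q <= #|A|%:R - 1.
Proof.
move=> q0 q1.
pose qA x := \sum_y q x y; pose qB y := \sum_x q x y.
have qA_ge x y : q x y <= qA x.
  by rewrite /qA (bigD1 y)//= lerDl sumr_ge0.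
have qB_ge x y : q x y <= qB y.
  by rewrite /qB (bigD1 x)//= lerDl sumr_ge0.
have le x y : q x y - qA x * qB y <= q x y * ln (q x y / (qA x * qB y)) <=
    (if qA x == 0 then 0 else q x y / qA x) - q x y.
  have := q0 x y; rewrite le_eqVlt => /predU1P[<-|qxy].
    by rewrite !mul0r sub0r subr0 if_same lexx andbT oppr_le0 mulr_ge0// sumr_ge0.
  have a0 : 0 < qA x by exact: lt_le_trans (qA_ge x y).
  have b0 : 0 < qB y by exact: lt_le_trans (qB_ge x y).
  rewrite gt_eqF//; apply/andP; split.
    have : ln (qA x * qB y / q x y) <= qA x * qB y / q x y - 1.
      by rewrite ln_le_subr1 ?divr_gt0 ?mulr_gt0.
    rewrite -[X in ln X]invrK lnV ?posrE ?invr_gt0 ?divr_gt0 ?mulr_gt0//.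
    rewrite invf_div -(ler_pM2l qxy) mulrN mulrBr mulr1.
    by rewrite [q x y * (_ / q x y)]mulrC divfK ?gt_eqF// lerNl opprB.
  have : ln (q x y / (qA x * qB y)) <= q x y / (qA x * qB y) - 1.
    by rewrite ln_le_subr1 ?divr_gt0 ?mulr_gt0.
  rewrite -(ler_pM2l qxy) => /le_trans; apply.
  rewrite mulrBr mulr1 lerD2r ler_wpM2l//.
  by rewrite ler_pdivrMr ?mulr_gt0// mulKf ?gt_eqF.
have qB1 : \sum_y qB y = 1 by rewrite /qB exchange_big.
apply/andP; split.
  apply: (@le_trans _ _ (\sum_x \sum_y (q x y - qA x * qB y))); last first.
    by apply: ler_sum => x _; apply: ler_sum => y _; have /andP[] := le x y.
  under eq_bigr do rewrite sumrB -mulr_sumr qB1 mulr1.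
  by rewrite sumrB subrr.
apply: (@le_trans _ _ (\sum_x \sum_y
    ((if qA x == 0 then 0 else q x y / qA x) - q x y))).
  by apply: ler_sum => x _; apply: ler_sum => y _; have /andP[] := le x y.
under eq_bigr do rewrite sumrB.
rewrite sumrB q1 lerD2r -sumr_const; apply: ler_sum => x _.
case: eqP => [_|/eqP qAx]; first by rewrite big1.
by rewrite -mulr_suml divff.
Qed.

(** By [ln t <= t - 1], a term is at most [(1 / a) (q / b) (q - a b)], where [q / b <= 1] and
    [1 / a <= 1 / eta]. Only the marginal of [x] is bounded below: the observation has atoms of tiny
    mass. *)
Lemma mutual_information_le_dist (R : realType) (A B : finType) (q : A -> B -> R)
    (eta : R) :
  0 < eta -> (forall x y, 0 <= q x y) -> \sum_x \sum_y q x y = 1 ->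
  (forall x, eta <= \sum_y q x y) ->
  mutual_information q <= eta^-1 * \sum_x \sum_y
     `|q x y - (\sum_y' q x y') * (\sum_x' q x' y)|.
Proof.
move=> eta0 q0 q1 qeta.
rewrite mulr_sumr; apply: ler_sum => x _; rewrite mulr_sumr; apply: ler_sum => y _.
set a := \sum_y' _; set b := \sum_x' _.
have qb : q x y <= b by rewrite /b (bigD1 x)//= lerDl sumr_ge0.
have a0 : 0 < a := lt_le_trans eta0 (qeta x).
have := q0 x y; rewrite le_eqVlt => /predU1P[<-|qxy].
  by rewrite mul0r mulr_ge0// invr_ge0 ltW.
have b0 : 0 < b := lt_le_trans qxy qb.
have : ln (q x y / (a * b)) <= q x y / (a * b) - 1.
  by rewrite ln_le_subr1 ?divr_gt0 ?mulr_gt0.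
move=> /(ler_wpM2l (ltW qxy)) /le_trans; apply.
rewrite (_ : q x y * (_ - 1) = a^-1 * (q x y / b) * (q x y - a * b)); last first.
  by field; rewrite !gt_eqF.
apply: le_trans (ler_norm _) _; rewrite normrM ler_wpM2r//.
rewrite ger0_norm ?mulr_ge0 ?invr_ge0 ?(ltW qxy) ?(ltW a0) ?(ltW b0)//.
rewrite -[leRHS]mulr1 ler_pM ?invr_ge0 ?divr_ge0 ?(ltW qxy) ?(ltW a0) ?(ltW b0)//.
  by rewrite lef_pV2 ?posrE// qeta.
by rewrite ler_pdivrMr// mul1r.
Qed.

(** * Uniformly random permutations of the columns *)

Definition shuffle (A : Type) (n : nat) (s : 'S_n) (z : {ffun 'I_n -> A}) :
  {ffun 'I_n -> A} := [ffun j => z (s^-1%g j)].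

(** The image of the weight [F] under a uniform shuffle followed by [obs]. The weight may be signed,
    since differences of laws are pushed forward too; [obs] will forget the unobserved times. *)
Definition anonymized (R : realType) (A B : finType) (n : nat)
    (obs : {ffun 'I_n -> A} -> B) (F : {ffun 'I_n -> A} -> R) (y : B) : R :=
  n`!%:R^-1 * \sum_(s : 'S_n) \sum_(z | obs (shuffle s z) == y) F z.

Lemma shuffleM (A : Type) (n : nat) (s t : 'S_n) (z : {ffun 'I_n -> A}) :
  shuffle s (shuffle t z) = shuffle (t * s)%g z.
Proof. by apply/ffunP => j; rewrite !ffunE invMg permM. Qed.

Lemma shuffle1 (A : Type) (n : nat) (z : {ffun 'I_n -> A}) : shuffle 1%g z = z.
Proof. by apply/ffunP => j; rewrite !ffunE invg1 perm1. Qed.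

Section anonymized.
Context (R : realType) (A B : finType) (n : nat) (obs : {ffun 'I_n -> A} -> B).
Implicit Types F G : {ffun 'I_n -> A} -> R.

Lemma anonymizedB F G y :
  anonymized obs (fun z => F z - G z) y = anonymized obs F y - anonymized obs G y.
Proof.
rewrite /anonymized -mulrBr -sumrB; congr (_ * _).
by apply: eq_bigr => s _; rewrite -sumrB.
Qed.

Lemma anonymizedZ a F y :
  anonymized obs (fun z => a * F z) y = a * anonymized obs F y.
Proof.
rewrite /anonymized mulrCA; congr (_ * _); rewrite mulr_sumr.
by apply: eq_bigr => s _; rewrite mulr_sumr.
Qed.

Lemma anonymized_sum I (r : seq I) (P : pred I) (F : I -> {ffun 'I_n -> A} -> R) y :
  anonymized obs (fun z => \sum_(i <- r | P i) F i z) y =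
  \sum_(i <- r | P i) anonymized obs (F i) y.
Proof.
rewrite /anonymized -mulr_sumr exchange_big/=; congr (_ * _).
by apply: eq_bigr => s _; rewrite exchange_big.
Qed.

Lemma sum_anonymized F : \sum_y anonymized obs F y = \sum_z F z.
Proof.
rewrite -mulr_sumr exchange_big/=.
have sumE (s : 'S_n) : \sum_y \sum_(z | obs (shuffle s z) == y) F z = \sum_z F z.
  rewrite (exchange_big_dep predT)//=; apply: eq_bigr => z _.
  by rewrite (big_pred1 (obs (shuffle s z)))// => y; rewrite eq_sym.
under eq_bigr do rewrite sumE.
by rewrite sumr_const card_Sn -[X in _ * X]mulr_natl mulKf// pnatr_eq0 -lt0n fact_gt0.
Qed.

(** With [sum_anonymized], this makes anonymization an L1 contraction, so errors can be estimated on
    products, before the permutation. *)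
Lemma le_norm_anonymized F y :
  `|anonymized obs F y| <= anonymized obs (fun z => `|F z|) y.
Proof.
rewrite normrM ger0_norm ?invr_ge0// ler_wpM2l ?invr_ge0//.
apply: le_trans (ler_norm_sum _ _ _) _; apply: ler_sum => s _.
exact: ler_norm_sum.
Qed.

(** The uniform law on permutations is invariant under translation: the fixed relabelling [t] is
    absorbed by [s -> t s]. *)
Lemma anonymized_shuffle (t : 'S_n) F y :
  anonymized obs (fun z => F (shuffle t z)) y = anonymized obs F y.
Proof.
congr (_ * _); rewrite (reindex_inj (mulgI t))/=; apply: eq_bigr => s _.
rewrite [RHS](reindex_inj (h := shuffle t))//=.
  by apply: eq_bigl => z; rewrite shuffleM.
by move=> z w /(congr1 (shuffle t^-1)); rewrite !shuffleM mulgV !shuffle1.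
Qed.

End anonymized.

(** * Averages over exchangeable columns *)

Section exchangeable.
Context (R : realType) (A : finType) (n : nat).
Variables (J : {set 'I_n}) (i0 : 'I_n) (g : 'I_n -> A -> R) (phi : A -> R).
Hypothesis i0J : i0 \in J.
Hypothesis gJ : forall j, j \in J -> g j = g i0.
Hypothesis g_ge0 : forall i a, 0 <= g i a.
Hypothesis g_sum1 : forall i, \sum_a g i a = 1.
Hypothesis phi_le1 : forall a, `|phi a| <= 1.

(** For [j] in [J], swapping the columns [i0] and [j] preserves the product, as [g j = g i0], and
    turns [phi (z i0)] into [phi (z j)]. By [anonymized_shuffle] the image does not change, so it
    equals its average over [J]. *)
Lemma anonymized_average (B : finType) (obs : {ffun 'I_n -> A} -> B) y :
  anonymized obs (fun z => phi (z i0) * \prod_i g i (z i)) y =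
  anonymized obs
    (fun z => (#|J|%:R^-1 * \sum_(j in J) phi (z j)) * \prod_i g i (z i)) y.
Proof.
have J0 : #|J|%:R != 0 :> R by rewrite pnatr_eq0 -lt0n card_gt0; apply/set0Pn; exists i0.
transitivity (#|J|%:R^-1 * \sum_(j in J)
    anonymized obs (fun z => phi (z j) * \prod_i g i (z i)) y); last first.
  rewrite -anonymized_sum -anonymizedZ; congr (_ * _).
  apply: eq_bigr => s _; apply: eq_bigr => z _.
  by rewrite -mulrA mulr_suml.
rewrite (eq_bigr (fun=>
    anonymized obs (fun z => phi (z i0) * \prod_i g i (z i)) y)).
  by rewrite sumr_const -[X in _ * X]mulr_natl mulKf.
move=> j jJ; rewrite -(anonymized_shuffle obs (tperm i0 j)); congr (_ * _).
apply: eq_bigr => s _; apply: eq_bigr => z _.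
rewrite !ffunE tpermV tpermR; congr (_ * _).
rewrite (reindex_inj (@perm_inj _ (tperm i0 j)))/=; apply: eq_bigr => i _.
by rewrite ffunE tpermV tpermK; case: tpermP => [->|->|//]; rewrite (gJ jJ).
Qed.

Lemma product_moment i j : i \in J -> j \in J -> i != j ->
  \sum_(z : {ffun 'I_n -> A}) phi (z i) * phi (z j) * \prod_u g u (z u) =
  (\sum_a phi a * g i0 a) ^+ 2.
Proof.
move=> iJ jJ ij.
pose F u a := (if (u == i) || (u == j) then phi a else 1) * g u a.
have FE (z : {ffun 'I_n -> A}) :
    phi (z i) * phi (z j) * \prod_u g u (z u) = \prod_u F u (z u).
  rewrite big_split/=; congr (_ * _).
  rewrite (bigD1 i)//= eqxx/= (bigD1 j)/=; last by rewrite eq_sym.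
  rewrite eqxx orbT/= big1 ?mulr1// => u /andP[ui uj].
  by rewrite (negbTE ui) (negbTE uj).
under eq_bigr do rewrite FE.
rewrite sum_ffun_prod (bigD1 i)//= (bigD1 j)/=; last by rewrite eq_sym.
rewrite [X in _ * (_ * X)]big1 ?mulr1.
  rewrite expr2 /F eqxx/=. congr (_ * _); apply: eq_bigr => a _.
    by rewrite (gJ iJ).
  by rewrite eqxx orbT (gJ jJ).
move=> u /andP[ui uj]; rewrite /F (negbTE ui) (negbTE uj)/=.
by under eq_bigr do rewrite mul1r.
Qed.

(** The columns are independent: when the square is expanded, each of the [#|J|] diagonal terms is
    at most 1 and each off-diagonal one at most [c ^+ 2]. *)
Lemma second_moment_le c : `|\sum_a phi a * g i0 a| <= c ->
  \sum_(z : {ffun 'I_n -> A})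
    (#|J|%:R^-1 * \sum_(j in J) phi (z j)) ^+ 2 * \prod_u g u (z u) <=
  #|J|%:R^-1 + c ^+ 2.
Proof.
move=> hc.
have J0 : 0 < #|J|%:R :> R by rewrite ltr0n card_gt0; apply/set0Pn; exists i0.
pose E i j := \sum_(z : {ffun 'I_n -> A}) phi (z i) * phi (z j) * \prod_u g u (z u).
have hE i j : i \in J -> j \in J -> E i j <= (i == j)%:R + c ^+ 2.
  move=> iJ jJ; have [<-|ij] := eqVneq i j.
    apply: (@le_trans _ _ 1); last by rewrite lerDl sqr_ge0.
    rewrite -[leRHS](_ : \sum_(z : {ffun 'I_n -> A}) \prod_u g u (z u) = 1).
      apply: ler_sum => z _; rewrite ler_piMl ?prodr_ge0//.
      by rewrite -expr2 -[_ ^+ 2]ger0_norm ?sqr_ge0// normrX exprn_ile1.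
    by rewrite sum_ffun_prod big1.
  rewrite add0r /E product_moment// -real_normK ?num_real//.
  by rewrite lerXn2r ?nnegrE// (le_trans _ hc).
have -> : \sum_(z : {ffun 'I_n -> A})
    (#|J|%:R^-1 * \sum_(j in J) phi (z j)) ^+ 2 * \prod_u g u (z u) =
    #|J|%:R^-1 ^+ 2 * \sum_(i in J) \sum_(j in J) E i j.
  rewrite /E; under [in RHS]eq_bigr do rewrite exchange_big/=.
  rewrite exchange_big/= mulr_sumr; apply: eq_bigr => z _.
  rewrite exprMn -mulrA; congr (_ * _).
  rewrite expr2 big_distrlr/= mulr_suml; apply: eq_bigr => i _.
  by rewrite mulr_suml.
apply: (@le_trans _ _ (#|J|%:R^-1 ^+ 2 *
    \sum_(i in J) \sum_(j in J) ((i == j)%:R + c ^+ 2))).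
  rewrite ler_wpM2l ?sqr_ge0//; apply: ler_sum => i iJ; apply: ler_sum => j jJ.
  exact: hE.
rewrite (eq_bigr (fun=> 1 + #|J|%:R * c ^+ 2)); last first.
  move=> i iJ; rewrite big_split/= sumr_const -[_ *+ _]mulr_natl; congr (_ + _).
  rewrite (bigD1 i)//= eqxx big1 ?addr0// => j /andP[_ ji].
  by rewrite eq_sym (negbTE ji).
rewrite sumr_const -[_ *+ _]mulr_natl.
by rewrite le_eqVlt; apply/orP; left; apply/eqP; field; rewrite gt_eqF.
Qed.

Lemma sum_norm_anonymized_le (B : finType) (obs : {ffun 'I_n -> A} -> B) c gam :
  0 < gam -> `|\sum_a phi a * g i0 a| <= c ->
  \sum_y `|anonymized obs (fun z => phi (z i0) * \prod_i g i (z i)) y| <=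
  gam + (#|J|%:R^-1 + c ^+ 2) / gam.
Proof.
move=> gam0 hc.
under eq_bigr do rewrite anonymized_average.
apply: le_trans (ler_sum _ (fun y _ => le_norm_anonymized _ _ y)) _.
rewrite sum_anonymized.
pose t (z : {ffun 'I_n -> A}) := #|J|%:R^-1 * \sum_(j in J) phi (z j).
apply: (@le_trans _ _ (\sum_(z : {ffun 'I_n -> A})
    (gam + t z ^+ 2 / gam) * \prod_u g u (z u))).
  apply: ler_sum => z _; rewrite normrM [X in _ * X]ger0_norm ?prodr_ge0//.
  rewrite ler_wpM2r ?prodr_ge0// -/(t z).
  (* This gives [2 |t| <= gam + t ^+ 2 / gam], which stands in for Cauchy-Schwarz and leaves [gam]
     free for later tuning. *)
  have : 0 <= (gam - `|t z|) ^+ 2 / gam by rewrite divr_ge0 ?sqr_ge0// ltW.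
  rewrite -[t z ^+ 2]real_normK ?num_real//.
  have -> : (gam - `|t z|) ^+ 2 / gam =
     (gam + `|t z| ^+ 2 / gam) - 2 * `|t z| by field; rewrite gt_eqF.
  by have := normr_ge0 (t z); lra.
under eq_bigr do rewrite mulrDl mulrAC.
rewrite big_split/= -mulr_sumr -mulr_suml sum_ffun_prod big1// mulr1 lerD2l.
by rewrite ler_wpM2r ?invr_ge0 ?(ltW gam0)// second_moment_le.
Qed.

End exchangeable.

(** * Obfuscated columns *)

Section primitive.
Context {R : realType}.
Implicit Types P Q : {poly R}.

(** For [i = 0] the division by [0%:R] yields 0, so this is the primitive that vanishes at 0. *)
Definition prim P : {poly R} := \poly_(i < (size P).+1) (P`_i.-1 / i%:R).

Lemma coef_prim P i : (prim P)`_i = P`_i.-1 / i%:R.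
Proof.
rewrite coef_poly; case: ltnP => // Pi.
by case: i Pi => // i Pi; rewrite [P`__]nth_default ?mul0r.
Qed.

Lemma primD P Q : prim (P + Q) = prim P + prim Q.
Proof. by apply/polyP => i; rewrite coefD !coef_prim coefD mulrDl. Qed.

Lemma primZ c P : prim (c *: P) = c *: prim P.
Proof. by apply/polyP => i; rewrite coefZ !coef_prim coefZ mulrA. Qed.

Lemma prim_sum I (r : seq I) (p : pred I) (F : I -> {poly R}) :
  prim (\sum_(i <- r | p i) F i) = \sum_(i <- r | p i) prim (F i).
Proof.
apply: (big_morph _ primD); apply/polyP => i.
by rewrite coef_prim !coef0 mul0r.
Qed.

Lemma deriv_prim P : (prim P)^`() = P.
Proof.
apply/polyP => i; rewrite coef_deriv coef_prim/= -[LHS]mulr_natr divfK//.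
Qed.

Lemma prim_deriv P : prim P^`() = P - (P.[0])%:P.
Proof.
apply/polyP => -[|i]; rewrite coefB coef_prim coefC/=.
  by rewrite invr0 mulr0 horner_coef0 subrr.
by rewrite subr0 coef_deriv -[_ *+ _]mulr_natr mulfK// pnatr_eq0.
Qed.

Lemma prim1 : prim 1 = 'X :> {poly R}.
Proof. by rewrite -derivX prim_deriv hornerX polyC0 subr0. Qed.

Lemma integral_horner P (a b : R) : a < b ->
  (\int[lebesgue_measure]_(x in `[a, b]) (P.[x])%:E =
   ((prim P).[b] - (prim P).[a])%:E)%E.
Proof.
move=> ab; rewrite (@continuous_FTC2 _ (horner P) (horner (prim P)))//.
- exact/continuous_subspaceT/continuous_horner.
- split.
  + by move=> x _; exact: derivable_horner.
  + exact/cvg_at_right_filter/continuous_horner.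
  + exact/cvg_at_left_filter/continuous_horner.
- by move=> x _; rewrite -derivE deriv_prim.
Qed.

Lemma le_prim P (a b : R) : a <= b -> (forall x, a <= x <= b -> 0 <= P.[x]) ->
  (prim P).[a] <= (prim P).[b].
Proof.
rewrite le_eqVlt => /predU1P[->//|ab] P0.
rewrite -subr_ge0 -lee_fin -integral_horner//.
by apply: integral_ge0 => x /=; rewrite in_itv/= lee_fin => /P0.
Qed.

(** The mean of [P] under the uniform law on [0, [a]]. *)
Definition poly_mean (a : R) P : R := (prim P).[a] / a.

Lemma poly_mean_ge0 a P : 0 <= a -> (forall x, 0 <= x <= a -> 0 <= P.[x]) ->
  0 <= poly_mean a P.
Proof.
move=> a0 P0; rewrite divr_ge0// (le_trans _ (le_prim a0 P0))//.
by rewrite horner_coef0 coef_prim invr0 mulr0.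
Qed.

Lemma poly_mean_sum a I (r : seq I) (p : pred I) (F : I -> {poly R}) :
  poly_mean a (\sum_(i <- r | p i) F i) = \sum_(i <- r | p i) poly_mean a (F i).
Proof. by rewrite /poly_mean prim_sum horner_sum mulr_suml. Qed.

Lemma poly_meanZ a c P : poly_mean a (c *: P) = c * poly_mean a P.
Proof. by rewrite /poly_mean primZ hornerZ mulrA. Qed.

Lemma poly_mean1 a : a != 0 -> poly_mean a 1 = 1.
Proof. by move=> a0; rewrite /poly_mean prim1 hornerX divff. Qed.

Lemma poly_meanX a : poly_mean a 'X = a / 2.
Proof.
rewrite /poly_mean (_ : prim 'X = 2^-1 *: 'X^2).
  have [->|a0] := eqVneq a 0; first by rewrite invr0 mulr0 mul0r.
  by rewrite hornerE hornerXn; field.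
apply/polyP => -[|[|[|i]]]; rewrite coef_prim coefZ coefXn coefX/=.
- by rewrite invr0 !mulr0.
- by rewrite mul0r mulr0.
- by rewrite mulr1 mul1r.
- by rewrite mul0r mulr0.
Qed.

End primitive.

(** * One user: data, flips and obfuscated column *)

Section channel.
Context {R : realType} (K : nat).
Local Notation col := {ffun 'I_K -> bool}.
Implicit Types (p q a : R) (x z b : col).

Definition bitX (c : bool) : {poly R} := if c then 'X else 1 - 'X.

Lemma horner_bitX c r : (bitX c).[r] = bernoulli_pmf r c.
Proof. by rewrite /bernoulli_pmf; case: c; rewrite /bitX !hornerE. Qed.

Definition colX z : {poly R} := \prod_i bitX (z i).

Lemma horner_colX z r : (colX z).[r] = \prod_i bernoulli_pmf r (z i).
Proof. by rewrite horner_prod; apply: eq_bigr => i _; exact: horner_bitX. Qed.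

Lemma colX_ge0 z r : 0 <= r <= 1 -> 0 <= (colX z).[r].
Proof.
by move=> r01; rewrite horner_colX prodr_ge0// => i _; exact: bernoulli_pmf_ge0.
Qed.

Lemma sum_colX : \sum_z colX z = 1.
Proof.
rewrite (sum_ffun_prod (fun _ c => bitX c)) big1// => i _.
by rewrite big_bool/= addrC subrK.
Qed.

Lemma sum_colX_bit k : \sum_(z : col | z k) colX z = 'X.
Proof.
rewrite big_mkcond/=.
pose F (i : 'I_K) c := if (i == k) && ~~ c then 0 else bitX c.
rewrite (eq_bigr (fun z : col => \prod_i F i (z i))) => [|z _].
  rewrite sum_ffun_prod (bigD1 k)//= [X in _ * X]big1 => [|i ik].
    by rewrite mulr1 big_bool/= /F eqxx/= addr0.
  by rewrite /F big_bool/= (negbTE ik) addrC subrK.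
case: ifPn => zk.
  apply: eq_bigr => i _; rewrite /F; case: eqP => // ->.
  by rewrite zk.
by rewrite (bigD1 k)//= /F eqxx zk mul0r.
Qed.

(** As the operation is an involution, [addcol x z] is also the pattern of flips that turns [x] into
    [z]. *)
Definition addcol x z : col := [ffun i => x i (+) z i].

Lemma addcolK x : involutive (addcol x).
Proof. by move=> z; apply/ffunP => i; rewrite !ffunE addKb. Qed.

Definition col_pmf p x : R := \prod_i bernoulli_pmf p (x i).

Lemma col_pmf_ge0 p x : 0 <= p <= 1 -> 0 <= col_pmf p x.
Proof. by move=> p01; rewrite prodr_ge0// => i _; exact: bernoulli_pmf_ge0. Qed.

Lemma col_pmfE p x : col_pmf p x = (colX x).[p].
Proof. by rewrite horner_colX. Qed.

Lemma sum_col_pmf p : \sum_x col_pmf p x = 1.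
Proof.
under eq_bigr do rewrite col_pmfE.
by rewrite -horner_sum sum_colX hornerC.
Qed.

Lemma sum_col_pmf_bit p k : \sum_(x : col | x k) col_pmf p x = p.
Proof.
under eq_bigr do rewrite col_pmfE.
by rewrite -horner_sum sum_colX_bit hornerX.
Qed.

(** Joint probability of the data [x] and the output [z], with the noise integrated out. The level
    is drawn once per user, hence a mean of a product over times rather than a product of means. *)
Definition channel a p x z : R := col_pmf p x * poly_mean a (colX (addcol x z)).

Definition output a p z : R := \sum_x channel a p x z.

Section bounded.
Variable a : R.
Hypothesis a01 : 0 < a <= 1.

Let a_gt0 : 0 < a. Proof. by case/andP: a01. Qed.

Lemma poly_mean_colX_ge0 z : 0 <= poly_mean a (colX z).
Proof.
apply: poly_mean_ge0; first exact: ltW.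
move=> x /andP[x0 xa]; apply: colX_ge0; rewrite x0/=.
by rewrite (le_trans xa)//; case/andP: a01.
Qed.

Lemma channel_ge0 p x z : 0 <= p <= 1 -> 0 <= channel a p x z.
Proof. by move=> p01; rewrite mulr_ge0 ?col_pmf_ge0 ?poly_mean_colX_ge0. Qed.

Lemma sum_channel p x : \sum_z channel a p x z = col_pmf p x.
Proof.
rewrite -mulr_sumr (reindex_inj (inv_inj (addcolK x)))/=.
under eq_bigr do rewrite addcolK.
by rewrite -poly_mean_sum sum_colX poly_mean1 ?gt_eqF// mulr1.
Qed.

Lemma output_ge0 p z : 0 <= p <= 1 -> 0 <= output a p z.
Proof. by move=> p01; rewrite sumr_ge0// => x _; exact: channel_ge0. Qed.

Lemma sum_output p : \sum_z output a p z = 1.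
Proof.
rewrite exchange_big/=; under eq_bigr do rewrite sum_channel.
exact: sum_col_pmf.
Qed.

Lemma outputE p z : (1 - 2 * p) * a * output a p z =
  (prim (colX z)).[p + (1 - 2 * p) * a] - (prim (colX z)).[p].
Proof.
pose l : {poly R} := p%:P + (1 - 2 * p) *: 'X.
have -> : output a p z = poly_mean a (colX z \Po l).
  rewrite /output /channel.
  under eq_bigr do rewrite -poly_meanZ.
  rewrite -poly_mean_sum; congr (poly_mean a _).
  rewrite /colX rmorph_prod/=.
  (* Time by time, summing over the hidden bit composes [bitX] with [l]. *)
  rewrite (eq_bigr (fun i : 'I_K => \sum_(c : bool)
      bernoulli_pmf p c *: bitX (c (+) z i))) => [|i _].
    rewrite -(sum_ffun_prod (fun i c => bernoulli_pmf p c *: bitX (c (+) z i))).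
    apply: eq_bigr => x _; rewrite scaler_prod; congr (_ *: _).
    by apply: eq_bigr => i _; rewrite ffunE.
  rewrite big_bool/= /bernoulli_pmf /bitX /l; case: (z i) => /=.
    by rewrite comp_polyX -!mul_polyC; ring.
  by rewrite rmorphB rmorph1/= comp_polyX -!mul_polyC; ring.
set G := prim (colX z).
have dG : (G \Po l)^`() = (1 - 2 * p) *: (colX z \Po l).
  rewrite deriv_comp deriv_prim /l derivD derivC derivZ derivX add0r.
  by rewrite mulrC alg_polyC mul_polyC.
rewrite /poly_mean (_ : _ * _ * (_ / a) =
  (1 - 2 * p) * (prim (colX z \Po l)).[a]); last by field; rewrite gt_eqF.
by rewrite -hornerZ -primZ -dG prim_deriv !hornerE !horner_comp /l !hornerE.
Qed.

(** The polynomials [colX z] are nonnegative on [0, 1] and add up to 1, so their increments over an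
    interval share one sign and add up to its length, whatever [K]. *)
Lemma sum_dist_prim u v : 0 <= u <= 1 -> 0 <= v <= 1 ->
  \sum_z `|(prim (colX z)).[u] - (prim (colX z)).[v]| = `|u - v|.
Proof.
wlog vu : u v / v <= u => [H u01 v01|/andP[u0 u1] /andP[v0 v1]].
  have [/H|/ltW/H] := leP v u; first exact.
  by rewrite distrC => <- //; apply: eq_bigr => z _; rewrite distrC.
rewrite ger0_norm ?subr_ge0//.
under eq_bigr => z _.
  rewrite ger0_norm; last first.
    rewrite subr_ge0 le_prim// => x /andP[vx xu].
    by rewrite colX_ge0// (le_trans v0)//= (le_trans xu).
  over.
by rewrite sumrB -!horner_sum -!prim_sum sum_colX prim1 !hornerX.
Qed.

(** By [outputE], one end of the interval moves by [|p - q|], the other by [|1 - 2 a| |p - q|], and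
    changing the factor [1 - 2 p] costs [2 a |p - q|]. Since [a <= 1], the total is at most four
    times [|p - q|]. *)
Lemma output_dist p q : 0 <= p <= 1 -> 0 <= q <= 1 ->
  `|1 - 2 * p| * a * \sum_z `|output a p z - output a q z| <= 4 * `|p - q|.
Proof.
move=> p01 q01; have [a0 a1] := andP a01.
have l01 r : 0 <= r <= 1 -> 0 <= r + (1 - 2 * r) * a <= 1.
  move=> /andP[r0 r1].
  have -> : r + (1 - 2 * r) * a = (1 - a) * r + a * (1 - r) by ring.
  by apply/andP; split; nra.
set G := fun z => prim (colX z).
apply: (@le_trans _ _ (\sum_z
  (`|(G z).[p + (1 - 2 * p) * a] - (G z).[q + (1 - 2 * q) * a]| +
   `|(G z).[q] - (G z).[p]| + 2 * a * `|p - q| * output a q z))).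
  rewrite mulr_sumr; apply: ler_sum => z _.
  rewrite -[X in _ * X * _](ger0_norm (ltW a0)) -!normrM.
  have -> : (1 - 2 * p) * a * (output a p z - output a q z) =
    ((G z).[p + (1 - 2 * p) * a] - (G z).[q + (1 - 2 * q) * a]) +
    ((G z).[q] - (G z).[p]) + 2 * a * (p - q) * output a q z.
    rewrite (_ : _ * (_ - _) = (1 - 2 * p) * a * output a p z
      - (1 - 2 * q) * a * output a q z + 2 * a * (p - q) * output a q z).
      by rewrite !outputE /G; ring.
    by ring.
  apply: le_trans (ler_normD _ _) _; apply: lerD; first exact: ler_normD.
  by rewrite !normrM (ger0_norm (output_ge0 _ q01)) (ger0_norm (ltW a0)) ger0_norm.
rewrite !big_split/= -mulr_sumr sum_output mulr1 !sum_dist_prim ?l01//.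
have -> : p + (1 - 2 * p) * a - (q + (1 - 2 * q) * a) = (1 - 2 * a) * (p - q).
  by ring.
rewrite [X in _ + X + _]distrC normrM.
have : `|1 - 2 * a| <= 1 by rewrite ler_norml; apply/andP; split; lra.
by have := normr_ge0 (p - q); nra.
Qed.

Section signal.
Variables (p : R) (k : 'I_K).
Hypothesis p01 : 0 <= p <= 1.

(** The expectation of [X(k) - p] on the event that the output is [z], that is, what a column tells
    about the bit [k]. It is not small in L1 norm by itself; anonymization is what makes it
    harmless. *)
Definition signal z : R := \sum_(x : col) ((x k)%:R - p) * channel a p x z.

Lemma sum_norm_signal_le1 : \sum_z `|signal z| <= 1.
Proof.
rewrite -(sum_output p); apply: ler_sum => z _.
apply: le_trans (ler_norm_sum _ _ _) _; apply: ler_sum => x _.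
rewrite normrM [X in _ * X]ger0_norm ?channel_ge0// ler_piMl ?channel_ge0//.
have /andP[p0 p1] := p01.
by case: (x k) => /=; rewrite ler_norml; apply/andP; split; lra.
Qed.

Lemma sum_signal : \sum_z signal z = 0.
Proof.
rewrite exchange_big/=; under eq_bigr do rewrite -mulr_sumr sum_channel.
under eq_bigr do rewrite mulrBl.
rewrite sumrB -mulr_sumr sum_col_pmf mulr1 -[X in _ - X](sum_col_pmf_bit p k).
rewrite [X in _ - X]big_mkcond/= -sumrB big1// => x _.
by case: (x k); rewrite ?mul1r ?mul0r subrr.
Qed.

(** The difference at [z] is at most the probability that the output is [z] and the bit [k] was
    flipped; summed over [z], this is the mean level [a / 2]. *)
Lemma signal_dist :
  \sum_z `|signal z - ((z k)%:R - p) * output a p z| <= a.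
Proof.
apply: (@le_trans _ _ (\sum_z \sum_(x : col | addcol x z k) channel a p x z)).
  apply: ler_sum => z _; rewrite /signal /output mulr_sumr -sumrB.
  rewrite [leRHS]big_mkcond/=; apply: le_trans (ler_norm_sum _ _ _) _.
  apply: ler_sum => x _; rewrite -mulrBl ffunE.
  have c0 := channel_ge0 x z p01.
  by case: (x k); case: (z k) => /=; rewrite normrM (ger0_norm c0) opprB
    addrA ?subrK ?subrr ?normr0 ?mul0r// ?sub0r ?subr0 ?normrN1 ?normr1 ?mul1r//.
rewrite (exchange_big_dep predT)//=.
under eq_bigr => x _.
  rewrite (reindex_inj (inv_inj (addcolK x)))/=.
  rewrite (eq_bigl (fun z => z k)); last by move=> z; rewrite addcolK.
  rewrite -mulr_sumr; under eq_bigr do rewrite addcolK.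
  rewrite -poly_mean_sum sum_colX_bit poly_meanX.
  over.
by rewrite -mulr_suml sum_col_pmf mul1r; have := a_gt0; lra.
Qed.

End signal.
End bounded.
End channel.

(** * The conditional joint law *)

Lemma sum_ffun_prod_weight (R : comNzRingType) (I A : finType) (i0 : I)
    (h : A -> R) (F : I -> A -> R) :
  \sum_(z : {ffun I -> A}) h (z i0) * \prod_i F i (z i) =
  (\sum_a h a * F i0 a) * \prod_(i | i != i0) \sum_a F i a.
Proof.
pose F' i a := if i == i0 then h a * F i0 a else F i a.
rewrite (eq_bigr (fun z : {ffun I -> A} => \prod_i F' i (z i))) => [|z _].
  rewrite sum_ffun_prod (bigD1 i0)//= /F' eqxx; congr (_ * _).
  by apply: eq_bigr => i /negbTE ->.
rewrite (bigD1 i0)//= [RHS](bigD1 i0)//= /F' eqxx mulrA; congr (_ * _).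
by apply: eq_bigr => i /negbTE ->.
Qed.

Section joint_law.
Context {R : realType} (n K : nat) (B : finType).
Local Notation col := {ffun 'I_K -> bool}.
Variables (obs : {ffun 'I_n.+1 -> col} -> B) (k : 'I_K) (a : R).
Implicit Types (p : 'I_n.+1 -> R).

(** The candidate for the law of the bit [k] of user 1 and of the observation given the parameters,
    confirmed by [is_cond_prob_joint_law]. *)
Definition joint_law p (x : bool) (y : B) : R :=
  anonymized obs (fun z =>
    \sum_(x' : {ffun 'I_n.+1 -> col} | x' ord0 k == x)
       \prod_u channel a (p u) (x' u) (z u)) y.

Hypothesis a01 : 0 < a <= 1.

Lemma joint_law_ge0 p x y : (forall u, 0 <= p u <= 1) -> 0 <= joint_law p x y.
Proof.
move=> p01; rewrite mulr_ge0 ?invr_ge0// !sumr_ge0// => s _.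
by do 2 (rewrite sumr_ge0// => ? _); rewrite prodr_ge0// => u _; exact: channel_ge0.
Qed.

Lemma sum_joint_law p x : \sum_y joint_law p x y = bernoulli_pmf (p ord0) x.
Proof.
rewrite sum_anonymized exchange_big/=.
under eq_bigr => x' _.
  rewrite (sum_ffun_prod (fun u z => channel a (p u) (x' u) z)).
  under eq_bigr do rewrite sum_channel//.
  over.
rewrite big_mkcond/= (eq_bigr (fun x' : {ffun 'I_n.+1 -> col} =>
  (x' ord0 k == x)%:R * \prod_u col_pmf (p u) (x' u))); last first.
  by move=> x' _; case: eqP => _; rewrite ?mul1r ?mul0r.
have /= -> := sum_ffun_prod_weight ord0 (fun c : col => (c k == x)%:R)
  (fun u => col_pmf (p u)).
rewrite [X in _ * X]big1 ?mulr1 => [|u _]; last by rewrite sum_col_pmf.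
rewrite (eq_bigr (fun c : col => if c k == x then col_pmf (p ord0) c else 0)).
  rewrite -big_mkcond/=; case: x => /=.
    by under eq_bigl do rewrite eqb_id; rewrite sum_col_pmf_bit.
  under eq_bigl do rewrite eqbF_neg.
  have := sum_col_pmf K (p ord0).
  by rewrite (bigID (fun c : col => c k))/= sum_col_pmf_bit => /(canRL (addKr _)) ->;
    rewrite /bernoulli_pmf addrC.
by move=> c _; case: eqP => _; rewrite ?mul1r ?mul0r.
Qed.

Lemma sum_joint_law_bit p y : \sum_x joint_law p x y =
  anonymized obs (fun z => \prod_u output a (p u) (z u)) y.
Proof.
rewrite -anonymized_sum; congr (_ * _); apply: eq_bigr => s _.
apply: eq_bigr => z _; rewrite /output.
rewrite -(sum_ffun_prod (fun u c => channel a (p u) c (z u))).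
rewrite [RHS](partition_big (fun x' : {ffun 'I_n.+1 -> col} => x' ord0 k) predT)//=.
Qed.

(** Centering the bit at its mean turns the factor of user 1 into [signal], while the hidden data of
    the other users sum out to [output]. *)
Lemma joint_law_dist p y :
  joint_law p true y - p ord0 * \sum_x joint_law p x y =
  anonymized obs (fun z => \prod_u
    (if u == ord0 then signal a (p ord0) k (z u) else output a (p u) (z u))) y.
Proof.
rewrite sum_joint_law_bit -anonymizedZ -anonymizedB; congr (_ * _).
apply: eq_bigr => s _; apply: eq_bigr => z _.
have -> : \prod_u (if u == ord0 then signal a (p ord0) k (z u)
                    else output a (p u) (z u)) =
    \sum_(x' : {ffun 'I_n.+1 -> col})
      ((x' ord0 k)%:R - p ord0) * \prod_u channel a (p u) (x' u) (z u).
  have /= -> := sum_ffun_prod_weight ord0 (fun c : col => (c k)%:R - p ord0)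
    (fun u c => channel a (p u) c (z u)).
  rewrite (bigD1 ord0)//=; congr (_ * _).
  by apply: eq_bigr => u /negbTE ->.
under [RHS]eq_bigr do rewrite mulrBl.
rewrite sumrB -mulr_sumr /output.
rewrite -(sum_ffun_prod (fun u c => channel a (p u) c (z u))); congr (_ - _).
rewrite big_mkcond/=; apply: eq_bigr => x' _.
by case: (x' ord0 k); rewrite ?mul1r ?mul0r.
Qed.

Lemma joint_law_dist_false p y :
  joint_law p false y - (1 - p ord0) * \sum_x joint_law p x y =
  - (joint_law p true y - p ord0 * \sum_x joint_law p x y).
Proof. by rewrite big_bool/=; ring. Qed.

(** The factors [F] are replaced by [G], where user 1 carries [phi] times its output law and all of
    [J] shares that law. This replacement costs the first two terms, by [sum_prod_dist]; the product
    of the [G u] is then exchangeable over [J] up to [phi], and [sum_norm_anonymized_le] gives the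
    rest. *)
Lemma sum_joint_law_dist_le p (J : {set 'I_n.+1}) (eps eta gam : R) :
  (forall u, 0 <= p u <= 1) -> 0 < eta -> 0 < gam -> eta <= `|1 - 2 * p ord0| ->
  ord0 \in J -> (forall j, j \in J -> `|p ord0 - p j| <= eps * a) ->
  \sum_y `|joint_law p true y - p ord0 * \sum_x joint_law p x y| <=
  a + #|J|%:R * (4 * eps / eta) + (gam + (#|J|%:R^-1 + a ^+ 2) / gam).
Proof.
move=> p01 eta0 gam0 peta J0 Jp; have [a0 a1] := andP a01.
under eq_bigr do rewrite joint_law_dist.
set F := fun (u : 'I_n.+1) (c : col) => if u == ord0 then signal a (p ord0) k c else output a (p u) c.
pose phi (c : col) := (c k)%:R - p ord0.
pose g (u : 'I_n.+1) (c : col) := if u \in J then output a (p ord0) c else output a (p u) c.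
pose G (u : 'I_n.+1) (c : col) := if u == ord0 then phi c * output a (p ord0) c else g u c.
have phi1 c : `|phi c| <= 1.
  have /andP[p0 p1] := p01 ord0.
  by rewrite /phi; case: (c k) => /=; rewrite ler_norml; apply/andP; split; lra.
have g0 u c : 0 <= g u c by rewrite /g; case: ifP => _; exact: output_ge0.
have g1 u : \sum_c g u c = 1 by rewrite /g; case: (u \in J); rewrite (sum_output K a01).
have F1 u : \sum_c `|F u c| <= 1.
  rewrite /F; case: (u == ord0); first exact: sum_norm_signal_le1.
  rewrite (eq_bigr (output a (p u))) ?(sum_output K a01)// => c _.
  by rewrite ger0_norm// output_ge0.
have G1 u : \sum_c `|G u c| <= 1.
  rewrite -(g1 u); apply: ler_sum => c _.
  rewrite /G; case: eqP => [->|_]; last by rewrite ger0_norm.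
  by rewrite /g J0 normrM (ger0_norm (output_ge0 a01 _ (p01 _)))// ler_piMl// output_ge0.
(* As [signal] has total mass 0, this mean is, up to sign, the sum of the differences bounded by
   [signal_dist]. *)
have phig : `|\sum_c phi c * g ord0 c| <= a.
  apply: le_trans (signal_dist a01 k (p01 ord0)).
  rewrite (eq_bigr (fun c : col => ((c k)%:R - p ord0) * output a (p ord0) c)).
    rewrite -[leLHS]normrN -[X in `|X|]add0r -[X in `|X - _|](sum_signal a01 (p ord0) k).
    by rewrite -sumrB ler_norm_sum.
  by move=> c _; rewrite /g J0.
have FG u : \sum_c `|F u c - G u c| <=
    (if u == ord0 then a else 0) + (if u \in J then 4 * eps / eta else 0).
  rewrite /F /G /g; have [->|u0] := eqVneq u ord0.
    rewrite J0; apply: (le_trans (signal_dist a01 k (p01 ord0))); rewrite lerDl.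
    (* The closeness hypothesis at [ord0] itself reads [0 <= eps * a], whence [0 <= eps]. *)
    have := Jp _ J0; rewrite subrr normr0 pmulr_lge0// => eps0.
    by rewrite divr_ge0 ?mulr_ge0// ltW.
  rewrite add0r; have [uJ|uJ] := boolP (u \in J); last first.
    by rewrite big1// => c _; rewrite subrr normr0.
  rewrite ler_pdivlMr// -(ler_pM2r a0).
  set S := \sum_c _; have S0 : 0 <= S by exact: sumr_ge0.
  apply: (@le_trans _ _ (`|1 - 2 * p ord0| * a *
      \sum_(c : col) `|output a (p ord0) c - output a (p u) c|)).
    have -> : \sum_(c : col) `|output a (p ord0) c - output a (p u) c| = S.
      by apply: eq_bigr => c _; rewrite distrC.
    have := ler_wpM2l S0 (ler_wpM2r (ltW a0) peta).
    by rewrite mulrA [S * (`|_| * _)]mulrC.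
  apply: le_trans (output_dist K a01 (p01 _) (p01 _)) _.
  by rewrite -mulrA ler_wpM2l// Jp.
apply: (@le_trans _ _ (\sum_y
   (`|anonymized obs (fun z => \prod_u F u (z u) - \prod_u G u (z u)) y| +
    `|anonymized obs (fun z => \prod_u G u (z u)) y|))).
  apply: ler_sum => y _; rewrite anonymizedB.
  by rewrite -[X in `|X| <= _](subrK (anonymized obs (fun z => \prod_u G u (z u)) y))
    ler_normD.
rewrite big_split/= lerD//.
  apply: le_trans (ler_sum _ (fun y _ => le_norm_anonymized _ _ y)) _.
  rewrite sum_anonymized.
  apply: le_trans (sum_prod_dist F1 G1) _.
  apply: le_trans (ler_sum _ (fun u _ => FG u)) _.
  by rewrite big_split/= -!big_mkcond/= big_pred1_eq sumr_const -[_ *+ #|J|]mulr_natl.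
rewrite (eq_bigr (fun y => `|anonymized obs (fun z : {ffun 'I_n.+1 -> col} =>
    phi (z ord0) * \prod_(u < n.+1) g u (z u)) y|)); last first.
  move=> y _; congr `|_ * _|; apply: eq_bigr => s _; apply: eq_bigr => z _.
  rewrite (bigD1 ord0)//= [in RHS](bigD1 ord0)//= mulrA.
  congr (_ * _); first by rewrite /G eqxx /g J0.
  by apply: eq_bigr => u /negbTE u0; rewrite /G u0.
apply: (sum_norm_anonymized_le (J := J)) => // j jJ.
by rewrite /g jJ J0.
Qed.

(** Both values of the bit contribute the same distance, by [joint_law_dist_false], hence the factor
    2. *)
Lemma mutual_information_joint_law_le p (J : {set 'I_n.+1}) (eps eta gam : R) :
  (forall u, 0 <= p u <= 1) -> 0 < eta -> 0 < gam -> eta <= `|1 - 2 * p ord0| ->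
  eta <= p ord0 <= 1 - eta ->
  ord0 \in J -> (forall j, j \in J -> `|p ord0 - p j| <= eps * a) ->
  mutual_information (joint_law p) <= 2 / eta *
    (a + #|J|%:R * (4 * eps / eta) + (gam + (#|J|%:R^-1 + a ^+ 2) / gam)).
Proof.
move=> p01 eta0 gam0 peta /andP[etap petaC] J0 Jp.
apply: (le_trans (mutual_information_le_dist eta0 _ _ _)).
- by move=> x y; exact: joint_law_ge0.
- by under eq_bigr do rewrite sum_joint_law; rewrite big_bool/= addrC subrK.
- move=> x; rewrite sum_joint_law; case: x => //=.
  by rewrite /bernoulli_pmf; lra.
rewrite [leRHS]mulrAC [leRHS]mulrC ler_wpM2l ?invr_ge0 ?(ltW eta0)//.
rewrite (eq_bigr (fun=> \sum_y `|joint_law p true y - p ord0 * \sum_x joint_law p x y|)).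
  by rewrite big_bool/= -[leLHS]mulr2n -[leLHS]mulr_natl ler_wpM2l//; exact: sum_joint_law_dist_le.
move=> x _; apply: eq_bigr => y _; rewrite sum_joint_law.
by case: x => //=; rewrite /bernoulli_pmf joint_law_dist_false normrN.
Qed.

Lemma mutual_information_joint_law_bounds p : (forall u, 0 <= p u <= 1) ->
  0 <= mutual_information (joint_law p) <= 1.
Proof.
move=> p01; rewrite -[X in _ <= _ <= X](_ : #|{: bool}|%:R - 1 = 1).
  apply: mutual_information_bounds => [x y|]; first exact: joint_law_ge0.
  by under eq_bigr do rewrite sum_joint_law; rewrite big_bool/= addrC subrK.
by rewrite card_bool; lra.
Qed.

End joint_law.

(** * The law of the model *)

Section independent_factor.
Context d d' (T : measurableType d) (S : measurableType d') (R : realType).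
Variables (mu : {measure set T -> \bar R}) (U : {measure set S -> \bar R}).
Variables (V : T -> S) (h : T -> R) (c : R).
Hypothesis mV : measurable_fun [set: T] V.
Hypothesis mh : measurable_fun [set: T] h.
Hypothesis h0 : forall t, 0 <= h t.
Hypothesis hV : forall D : set S, measurable D ->
  (\int[mu]_t (h t * \1_D (V t))%:E = c%:E * U D)%E.

Import HBNNSimple.

Let factor_nnsfun (g : {nnsfun S >-> R}) :
  (\int[mu]_t (h t * g (V t))%:E = c%:E * \int[U]_s (g s)%:E)%E.
Proof.
pose sG := fset_set (range g) : seq R.
pose r i := nth 0 sG i; pose G i := g @^-1` [set r i].
pose n := size sG.
have r0 (i : 'I_n) : 0 <= r i.
  have : r i \in fset_set (range g) by exact: mem_nth.
  by rewrite in_fset_set// => /set_mem[s _ <-].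
have mG i : measurable (G i) by exact: measurable_funPTI.
have gE s : g s = \sum_(i < n) r i * \1_(G i) s by rewrite fimfunEord.
have mI i : measurable_fun [set: T] (fun t => h t * \1_(G i) (V t)).
  by apply: measurable_funM => //; exact: measurableT_comp.
transitivity (\sum_(i < n) (r i)%:E * (c%:E * U (G i)))%E.
  rewrite (eq_integral (fun t =>
      \sum_(i < n) (r i)%:E * (h t * \1_(G i) (V t))%:E)%E); last first.
    move=> t _; rewrite gE mulr_sumr -sumEFin; apply: eq_bigr => i _.
    by rewrite -EFinM mulrCA.
  rewrite ge0_integral_sum//; last 2 first.
  - by move=> i; apply: emeasurable_funM => //; exact/measurable_EFinP.
  - by move=> i t _; rewrite -EFinM lee_fin !mulr_ge0// indicE.
  apply: eq_bigr => i _; rewrite ge0_integralZl ?hV//.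
  - exact/measurable_EFinP.
  - by move=> t _; rewrite lee_fin mulr_ge0// indicE.
  - by rewrite lee_fin.
under [in RHS]eq_integral do rewrite gE.
rewrite (eq_integral (fun s => \sum_(i < n) (r i)%:E * (\1_(G i) s)%:E)%E); last first.
  by move=> s _; rewrite -sumEFin; apply: eq_bigr => i _; rewrite EFinM.
have mR i : measurable_fun [set: S] (fun s => (\1_(G i) s)%:E : \bar R).
  exact/measurable_EFinP.
rewrite ge0_integral_sum//; last 2 first.
- by move=> i; apply: emeasurable_funM.
- by move=> i s _; rewrite -EFinM lee_fin !mulr_ge0// indicE.
rewrite ge0_sume_distrr => [|i _]; last first.
  by rewrite integral_ge0// => s _; rewrite -EFinM lee_fin !mulr_ge0// indicE.
apply: eq_bigr => i _; rewrite ge0_integralZl//; last by rewrite lee_fin.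
by rewrite integral_indic// setIT muleCA.
Qed.

(** By [hV], the variable [V] has law [c U] under the density [h]. Simple functions increasing to
    [g] and monotone convergence extend this from sets to functions. *)
Lemma integral_independent_factor (g : S -> R) :
  measurable_fun [set: S] g -> (forall s, 0 <= g s) ->
  (\int[mu]_t (h t * g (V t))%:E = c%:E * \int[U]_s (g s)%:E)%E.
Proof.
move=> mg g0.
have mg' : measurable_fun [set: S] (EFin \o g) by exact/measurable_EFinP.
pose g_ := nnsfun_approx measurableT mg'.
have gcvg s : (g_ n s)%:E @[n --> \oo] --> (g s)%:E.
  by apply: (cvg_nnsfun_approx measurableT mg') => //= ? _; rewrite lee_fin.
transitivity (lim (\int[mu]_t (h t * g_ n (V t))%:E @[n --> \oo])%E).
  rewrite -monotone_convergence//=.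
  - apply: eq_integral => t _; apply/esym/cvg_lim => //.
    rewrite EFinM; under eq_fun do rewrite EFinM.
    by apply: cvgeZl => //; exact: gcvg.
  - move=> n; apply/measurable_EFinP/measurable_funM => //.
    exact: measurableT_comp.
  - by move=> n t _; rewrite lee_fin mulr_ge0.
  - move=> t _ m n mn; rewrite lee_fin ler_wpM2l//; exact/lefP/nd_nnsfun_approx.
rewrite [X in (_ * X)%E](_ : _ = lim (\int[U]_s (g_ n s)%:E @[n --> \oo])%E).
  rewrite -limeMl//.
    by apply: congr_lim; apply/funext => n; exact: factor_nnsfun.
  apply: ereal_nondecreasing_is_cvgn => m n mn; apply: ge0_le_integral => //=.
  - by move=> s _; rewrite lee_fin.
  - exact/measurable_EFinP.
  - exact/measurable_EFinP.
  - by move=> s _; rewrite lee_fin; exact/lefP/nd_nnsfun_approx.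
rewrite -monotone_convergence//=.
- by apply: eq_integral => s _; apply/esym/cvg_lim => //; exact: gcvg.
- by move=> n; exact/measurable_EFinP.
- by move=> n s _; rewrite lee_fin.
- by move=> s _ m n mn; rewrite lee_fin; exact/lefP/nd_nnsfun_approx.
Qed.

End independent_factor.

(** Independence is given on rectangles only. Indicators are turned into functions one coordinate at
    a time: at [u0], all other factors join the weight [h], and the identity on sets that
    [integral_independent_factor] requires there is the induction hypothesis. *)
Lemma integral_prod_independent d d' (T : measurableType d) (S : measurableType d')
    (R : realType) (mu : {measure set T -> \bar R}) (U : probability S R) (n : nat)
    (V : 'I_n -> T -> S) (h : T -> R) (c : R) :
  (forall u, measurable_fun [set: T] (V u)) ->
  measurable_fun [set: T] h -> (forall t, 0 <= h t) ->
  (forall C : 'I_n -> set S, (forall u, measurable (C u)) ->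
    (\int[mu]_t (h t * \prod_u \1_(C u) (V u t))%:E = c%:E * \prod_u U (C u))%E) ->
  forall (g : 'I_n -> S -> R) (e : 'I_n -> R),
  (forall u, measurable_fun [set: S] (g u)) -> (forall u s, 0 <= g u s) ->
  (forall u, (\int[U]_s (g u s)%:E = (e u)%:E)%E) ->
  (\int[mu]_t (h t * \prod_u g u (V u t))%:E = (c * \prod_u e u)%:E)%E.
Proof.
move=> mV mh h0 hC.
suff H (j : nat) (g : 'I_n -> S -> R) (e : 'I_n -> R) :
    (forall u, measurable_fun [set: S] (g u)) -> (forall u s, 0 <= g u s) ->
    (forall u, (\int[U]_s (g u s)%:E = (e u)%:E)%E) ->
    (forall u : 'I_n, (j <= u)%N -> exists2 C, measurable C & g u = \1_C) ->
    (\int[mu]_t (h t * \prod_u g u (V u t))%:E = (c * \prod_u e u)%:E)%E.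
  move=> g e mg g0 ge; apply: (H n) => // u.
  by rewrite leqNgt ltn_ord.
elim: j g e => [|j IH] g e mg g0 ge gC.
  have /choice[C hCu] : forall u, exists C, measurable C /\ g u = \1_C.
    by move=> u; have [C mC gE] := gC u (leq0n _); exists C.
  have -> : (\int[mu]_t (h t * \prod_u g u (V u t))%:E =
             \int[mu]_t (h t * \prod_u \1_(C u) (V u t))%:E)%E.
    apply: eq_integral => t _; congr (_ * _)%:E; apply: eq_bigr => u _.
    by rewrite (hCu u).2.
  rewrite hC; last by move=> u; exact: (hCu u).1.
  rewrite EFinM -prodEFin; congr (_ * _)%E; apply: eq_bigr => u _.
  rewrite -ge (hCu u).2 integral_indic ?setIT//; exact: (hCu u).1.
have [jn|nj] := ltnP j n; last first.
  apply: IH => // u ju; suff : (j < n)%N by rewrite ltnNge nj.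
  exact: leq_ltn_trans ju (ltn_ord u).
pose u0 := Ordinal jn.
have mgV u : measurable_fun [set: T] (fun t => g u (V u t)).
  exact: measurableT_comp.
have mprod : measurable_fun [set: T] (fun t => \prod_(u | u != u0) g u (V u t)).
  under eq_fun do rewrite -big_filter.
  by apply: measurable_prod => u _; exact: mgV.
under eq_integral do rewrite (bigD1 u0)//= [X in h _ * X]mulrC mulrA.
rewrite (integral_independent_factor (U := U)
    (h := fun t => h t * \prod_(u | u != u0) g u (V u t))
    (c := c * \prod_(u | u != u0) e u))//.
- by rewrite ge -EFinM [in RHS](bigD1 u0)//= -mulrA [e u0 * _]mulrC.
- exact: measurable_funM.
- by move=> t; rewrite mulr_ge0// prodr_ge0.
move=> D mD.
pose g' u := if u == u0 then \1_D else g u.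
pose e' u := if u == u0 then fine (U D) else e u.
have gE' t : \prod_u g' u (V u t) =
    \prod_(u | u != u0) g u (V u t) * \1_D (V u0 t).
  rewrite (bigD1 u0)//= mulrC {2}/g' eqxx; congr (_ * _).
  by apply: eq_bigr => u /negbTE uu0; rewrite /g' uu0.
have eE' : \prod_u e' u = \prod_(u | u != u0) e u * fine (U D).
  rewrite (bigD1 u0)//= mulrC {2}/e' eqxx; congr (_ * _).
  by apply: eq_bigr => u /negbTE uu0; rewrite /e' uu0.
under eq_integral do rewrite -mulrA -gE'.
rewrite (IH g' e').
- by rewrite eE' mulrA EFinM fineK// fin_num_measure.
- by move=> u; rewrite /g'; case: eqP.
- by move=> u s; rewrite /g'; case: eqP => // _; rewrite indicE.
- move=> u; rewrite /g' /e'; case: eqP => // _.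
  by rewrite integral_indic// setIT fineK// fin_num_measure.
- move=> u ju; rewrite /g'; have [_|uu0] := eqVneq u u0; first by exists D.
  apply: gC; rewrite ltn_neqAle ju andbT.
  by apply: contra uu0 => /eqP jE; apply/eqP/val_inj.
Qed.

Lemma measurable_forall d (T : measurableType d) (I : finType) (A : I -> set T) :
  (forall i, measurable (A i)) -> measurable [set t | forall i, A i t].
Proof.
move=> mA; rewrite (_ : [set t | _] = \bigcap_(i in [set: I]) A i); last first.
  by apply/seteqP; split=> t /= At i; [move=> _|]; exact: At.
by apply: fin_bigcap_measurable => // i _; exact: mA.
Qed.

Lemma measure_finite_partition d (T : measurableType d) (R : realType)
    (mu : {measure set T -> \bar R}) (F : finType) (V : T -> F) (E : set T)
    (a : pred F) :
  (forall v, measurable (E `&` V @^-1` [set v])) ->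
  mu (E `&` [set t | a (V t)]) = (\sum_(v | a v) mu (E `&` V @^-1` [set v]))%E.
Proof.
move=> mE.
have mS (s : seq F) : measurable (E `&` [set t | V t \in s]).
  rewrite (_ : _ `&` _ = \big[setU/set0]_(v <- s) (E `&` V @^-1` [set v])).
    by apply: bigsetU_measurable => v _; exact: mE.
  rewrite -bigcup_seq; apply/seteqP; split=> t /=.
    by move=> [Et Vs]; exists (V t).
  by move=> [v /= vs [Et ->]].
have H (s : seq F) : uniq s -> mu (E `&` [set t | V t \in s]) =
    (\sum_(v <- s) mu (E `&` V @^-1` [set v]))%E.
  elim: s => [_|v s IH /= /andP[vs us]].
    by rewrite big_nil (_ : _ `&` _ = set0) ?measure0//; apply/seteqP; split=> t [].
  rewrite big_cons -IH// -measureU//.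
    congr (mu _); apply/seteqP; split=> t /=.
      by rewrite in_cons => -[Et /orP[/eqP->|]]; [left|right].
    by rewrite in_cons => -[[Et ->]|[Et ->]]; rewrite ?eqxx ?orbT.
  apply/seteqP; split=> t // -[[_ /= ->] [_]].
  by rewrite /= (negbTE vs).
rewrite -big_filter -H ?filter_uniq ?index_enum_uniq//.
by congr (mu (_ `&` _)); apply/seteqP; split=> t /=; rewrite mem_filter mem_index_enum andbT.
Qed.

Lemma measurable_samples d (T : measurableType d) (n K : nat)
    (V : 'I_n -> nat -> T -> bool) (x : 'M[bool]_(K, n)) :
  (forall u k, measurable_fun [set: T] (V u k)) ->
  measurable (samples K V @^-1` [set x]).
Proof.
move=> mV.
rewrite (_ : _ @^-1` _ =
    [set t | forall i : 'I_K * 'I_n, V i.2 i.1 t = x i.1 i.2]).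
  apply: measurable_forall => i.
  have := mV i.2 i.1 measurableT [set x i.1 i.2].
  by rewrite setTI; exact.
apply/seteqP; split=> t /= H.
  by move=> i; rewrite -H mxE.
by apply/matrixP => k u; rewrite mxE (H (k, u)).
Qed.

Section model.
Context d (T : measurableType d) (R : realType) (Pr : probability T R).
Variables (n : nat) (f : R -> R) (a : R).
Variables (P : {RV Pr >-> n.-tuple R}) (X : 'I_n -> nat -> {RV Pr >-> bool}).
Variables (N : {RV Pr >-> n.-tuple R}) (Z : 'I_n -> nat -> {RV Pr >-> bool}).
Variable Pi : T -> 'S_n.
Hypothesis model : two_states_model f a P X N Z Pi.
Hypothesis a01 : 0 < a <= 1.

Let a_gt0 : 0 < a. Proof. by case/andP: a01. Qed.

(** The indicator is kept because [colX z] may be negative off [0, 1], whereas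
    [integral_prod_independent] wants functions that are nonnegative on the whole line. *)
Lemma uniform_prob_colX K (z : {ffun 'I_K -> bool}) :
  (\int[uniform_prob a_gt0]_r ((colX z).[r] * \1_(`[0, a]%classic) r)%:E =
   (poly_mean a (colX z))%:E)%E.
Proof.
have /andP[_ a1] := a01.
rewrite integral_uniform.
- rewrite subr0; under eq_integral => r ra do rewrite indicE ra mulr1.
  rewrite integral_horner// -EFinM /poly_mean mulrC; congr (_ / _)%:E.
  by rewrite [X in _ - X]horner_coef0 coef_prim invr0 mulr0 subr0.
- apply/measurable_EFinP/measurable_funM => //.
  exact: measurable_poly.
- move=> r; rewrite lee_fin indicE; case: (boolP (r \in _)) => /=.
    move=> /set_mem /=; rewrite in_itv/= => /andP[r0 ra]; rewrite mulr1 colX_ge0// r0/=.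
    exact: le_trans a1.
  by rewrite mulr0.
Qed.

Definition col_mx K (x : {ffun 'I_n -> {ffun 'I_K -> bool}}) : 'M[bool]_(K, n) :=
  \matrix_(k, u) x u k.

Let mP B : measurable B -> measurable (P @^-1` B).
Proof. by move=> mB; exact: measurable_funPTI. Qed.

Let mX K (x : 'M[bool]_(K, n)) : measurable (samples K X @^-1` [set x]).
Proof. by apply: (measurable_samples (V := fun u k => X u k)) => u k. Qed.

Let mZ K (z : 'M[bool]_(K, n)) : measurable (samples K Z @^-1` [set z]).
Proof. by apply: (measurable_samples (V := fun u k => Z u k)) => u k. Qed.

Lemma measurable_tnth_forall (C : 'I_n -> set R) : (forall u, measurable (C u)) ->
  measurable [set t : n.-tuple R | forall u, C u (tnth t u)].
Proof.
move=> mC; apply: measurable_forall => u.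
by have := measurable_tnth u measurableT (mC u); rewrite setTI.
Qed.

Lemma prob_samples K (x z : {ffun 'I_n -> {ffun 'I_K -> bool}}) (B : set (n.-tuple R)) :
  measurable B ->
  Pr (P @^-1` B `&` samples K X @^-1` [set col_mx x] `&`
      samples K Z @^-1` [set col_mx z]) =
  (Pr (P @^-1` B `&` samples K X @^-1` [set col_mx x]) *
   (\prod_u poly_mean a (colX (addcol (x u) (z u))))%:E)%E.
Proof.
move=> mB; set E := P @^-1` B `&` _; set SZ := samples K Z @^-1` _.
have mE : measurable E by apply: measurableI; [exact: mP|exact: mX].
pose I := `[0, a]%classic.
pose C := [set t : n.-tuple R | forall u, I (tnth t u)].
have mI : measurable I by exact: measurable_itv.
have mC : measurable C by apply: (measurable_tnth_forall (C := fun=> I)).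
have mNC : measurable (N @^-1` C) by exact: measurable_funPTI.
have mSZ : measurable SZ by exact: mZ.
(* Almost surely all levels lie in [0, [a]], so the event can be cut down to [C], on which the
   products of [g] are the flip probabilities. *)
have PrE : Pr (E `&` N @^-1` C) = Pr E.
  rewrite (noise_uniform model (col_mx x) mB (C := fun=> I))//.
  by rewrite big1 ?mule1// => u _; rewrite integral_uniform_pdf1.
have PrEC : Pr (E `\` N @^-1` C) = 0%E.
  rewrite measureD//; last by rewrite ltey_eq fin_num_measure.
  by rewrite [X in (_ - X)%E]PrE subee// fin_num_measure.
have -> : Pr (E `&` SZ) = Pr (E `&` N @^-1` C `&` SZ).
  rewrite [LHS](measureDI _ _ mNC); last exact: measurableI.
  rewrite (@subset_measure0 _ _ _ _ _ (E `\` N @^-1` C)) ?add0e//.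
  - by rewrite setIAC.
  - by apply: measurableD => //; exact: measurableI.
  - exact: measurableD.
  - by move=> t [[]].
rewrite (obfuscation model)// -/E.
pose g u r := (colX (addcol (x u) (z u))).[r] * \1_I r.
have -> : (\int[Pr]_(t in E `&` N @^-1` C) (\prod_u \prod_k
      bernoulli_pmf (tnth (N t) u) (col_mx z k u (+) col_mx x k u))%:E =
    \int[Pr]_t (\1_E t * \prod_u g u (tnth (N t) u))%:E)%E.
  rewrite integral_mkcond; apply: eq_integral => t _; rewrite patchE.
  have [/set_mem[Et NCt]|tEC] := boolP (t \in _).
    rewrite indicE mem_set// mul1r; congr _%:E; apply: eq_bigr => u _.
    rewrite /g indicE mem_set ?mulr1; last exact: NCt.
    by rewrite horner_colX; apply: eq_bigr => k _; rewrite !mxE ffunE addbC.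
  rewrite indicE; have [/set_mem Et|] := boolP (t \in E); last by rewrite mul0r.
  have : ~ C (N t) by move=> NCt; move/negP: tEC; apply; apply/mem_set.
  move=> /existsNP[u Iu]; rewrite mul1r (bigD1 u)//= /g indicE memNset//.
  by rewrite mulr0 mul0r.
(* The weight is the indicator of [E] and the constant is [Pr E]: the identity on rectangles is then
   [noise_uniform]. *)
rewrite (@integral_prod_independent _ _ _ _ _ Pr (uniform_prob a_gt0) n
  (fun u t => tnth (N t) u) (\1_E) (fine (Pr E)) _ _ _ _ g
  (fun u => poly_mean a (colX (addcol (x u) (z u)))))//.
- by rewrite EFinM fineK// fin_num_measure.
- move=> u; apply: (measurableT_comp (measurable_tnth u)) => //. exact: (measurable_funPT N).
- move=> D mD; rewrite fineK ?fin_num_measure//.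
  rewrite -(noise_uniform model (col_mx x) mB mD) -/E.
  set F := [set t | _]; have mF : measurable F.
    have := measurable_tnth_forall mD => mF.
    by have := @measurable_funPTI _ _ _ _ N _ mF.
  rewrite -[E `&` F]setIT -integral_indic//; last exact: measurableI.
  apply: eq_integral => t _; congr _%:E; have -> : \1_(E `&` F) t = \1_E t * \1_F t :> R by rewrite indicI.
  congr (_ * _).
  rewrite indicE; have [/set_mem Ft|tF] := boolP (t \in F).
    by rewrite big1// => u _; rewrite indicE mem_set//; exact: Ft.
  have : ~ F t by move=> Ft; move/negP: tF; apply; exact/mem_set.
  by move=> /existsNP[u Du]; rewrite (bigD1 u)//= indicE memNset// mul0r.
- by move=> u; apply: measurable_funM => //; exact: measurable_poly.
- move=> u r; rewrite /g indicE; have [/set_mem/=|] := boolP (r \in I).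
    rewrite /I /= in_itv/= => /andP[r0 ra]; rewrite mulr1 colX_ge0// r0/=.
    by case/andP: a01 => _; exact: le_trans.
  by rewrite mulr0.
- by move=> u; exact: uniform_prob_colX.
Qed.

End model.

Lemma joint_lawE (R : realType) (n K : nat) (B : finType)
    (obs : {ffun 'I_n.+1 -> {ffun 'I_K -> bool}} -> B) (k : 'I_K) (a : R)
    (p : 'I_n.+1 -> R) (x : bool) (y : B) :
  joint_law obs k a p x y =
  \sum_(v : 'S_n.+1 * {ffun 'I_n.+1 -> {ffun 'I_K -> bool}} *
            {ffun 'I_n.+1 -> {ffun 'I_K -> bool}}
        | (obs (shuffle v.1.1 v.1.2) == y) && (v.2 ord0 k == x))
    (n.+1)`!%:R^-1 * \prod_u channel a (p u) (v.2 u) (v.1.2 u).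
Proof.
rewrite /joint_law /anonymized -mulr_sumr; congr (_ * _).
rewrite pair_big_dep/= pair_big_dep/=; apply: eq_bigl => -[[s z] x']//.
Qed.

Section conditional_law.
Context d (T : measurableType d) (R : realType) (Pr : probability T R).
Variables (n : nat) (f : R -> R) (a : R).
Variables (P : {RV Pr >-> (n.+1).-tuple R}).
Variables (X : 'I_n.+1 -> nat -> {RV Pr >-> bool}).
Variables (N : {RV Pr >-> (n.+1).-tuple R}).
Variables (Z : 'I_n.+1 -> nat -> {RV Pr >-> bool}).
Variable Pi : T -> 'S_n.+1.
Hypothesis model : two_states_model f a P X N Z Pi.
Hypothesis a01 : 0 < a <= 1.

(** The factor [c] supplied by [prob_samples] does not involve the parameters, so it multiplies the
    version given by [data_bernoulli]. *)
Lemma is_cond_prob_channel K (x z : {ffun 'I_n.+1 -> {ffun 'I_K -> bool}}) :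
  is_cond_prob P (samples K X @^-1` [set col_mx x] `&`
                  samples K Z @^-1` [set col_mx z])
    (fun w => \prod_u channel a (tnth w u) (x u) (z u)).
Proof.
have [iX eX] := data_bernoulli model (col_mx x).
set g := (fun w => _) in iX eX.
pose c := \prod_u poly_mean a (colX (addcol (x u) (z u))).
have chE w : \prod_u channel a (tnth w u) (x u) (z u) = c * g w.
  rewrite /channel big_split/= mulrC; congr (_ * _); apply: eq_bigr => u _.
  by apply: eq_bigr => i _; rewrite !mxE.
split.
  rewrite (_ : EFin \o _ = fun w => (c%:E * (EFin \o g) w)%E); last first.
    by apply/funext => w /=; rewrite chE.
  exact: integrableZl.
move=> B mB; rewrite (eq_integral (fun w => (c%:E * (EFin \o g) w)%E)); last first.
  by move=> w _; rewrite /= chE.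
rewrite integralZl//; last exact: integrableS iX.
rewrite -eX// muleC [in RHS]setIC -(prob_samples model a01)//.
by congr (Pr _); rewrite setIC setIA.
Qed.

Variables (m k : nat).
(** The bit [k] may lie beyond the [m] observed times; this many times contain both. *)
Let K := (m + k.+1)%N.

Definition visible (w : {ffun 'I_n.+1 -> {ffun 'I_K -> bool}}) : 'M[bool]_(m, n.+1) :=
  \matrix_(i, j) w j (lshift k.+1 i).

Lemma time_lt : (k < K)%N. Proof. by rewrite /K addnS ltnS leq_addl. Qed.

(** The event is split along the finitely many values [v] of permutation, output and data;
    [permutation_uniform] and [is_cond_prob_channel] evaluate each piece, and [joint_lawE] has the
    matching form. *)
Lemma is_cond_prob_joint_law (x : bool) (y : 'M[bool]_(m, n.+1)) :
  is_cond_prob P (X ord0 k @^-1` [set x] `&` observation m Z Pi @^-1` [set y])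
    (fun w => joint_law visible (Ordinal time_lt) a (tnth w) x y).
Proof.
pose F : finType := ('S_n.+1 * {ffun 'I_n.+1 -> {ffun 'I_K -> bool}} *
                     {ffun 'I_n.+1 -> {ffun 'I_K -> bool}})%type.
pose A (v : F) := (visible (shuffle v.1.1 v.1.2) == y) &&
                  (v.2 ord0 (Ordinal time_lt) == x).
pose W (v : F) (w : (n.+1).-tuple R) := \prod_u channel a (tnth w u) (v.2 u) (v.1.2 u).
pose V (t : T) : F := (Pi t, [ffun u => [ffun i : 'I_K => Z u i t]],
                       [ffun u => [ffun i : 'I_K => X u i t]]).
have iW v : (distribution Pr P).-integrable setT (EFin \o W v).
  by have [] := is_cond_prob_channel v.2 v.1.2.
have jE w : (joint_law visible (Ordinal time_lt) a (tnth w) x y)%:E =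
    (\sum_(v | A v) ((n.+1)`!%:R^-1)%:E * (W v w)%:E)%E.
  by rewrite joint_lawE -sumEFin.
split.
  rewrite (_ : EFin \o _ =
    fun w => (\sum_(v | A v) ((n.+1)`!%:R^-1)%:E * (W v w)%:E)%E); last first.
    by apply/funext => w; exact: jE.
  by apply: integrable_sum => // v _; apply: integrableZl => //; exact: iW.
move=> B mB; under eq_integral do rewrite jE.
rewrite integral_sum//; last first.
  by move=> v; apply: integrableZl => //; exact: integrableS (iW v).
have mPB : measurable (P @^-1` B) by exact: measurable_funPTI.
pose E (v : F) := P @^-1` B `&` samples K X @^-1` [set col_mx v.2] `&` N @^-1` setT
  `&` samples K Z @^-1` [set col_mx v.1.2].
have VE v : P @^-1` B `&` V @^-1` [set v] = E v `&` Pi @^-1` [set v.1.1].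
  case: v => -[s z] x'; rewrite /E /V; apply/seteqP; split=> t /=.
    move=> [Pt [<- <- <-]]; do !split=> //.
      by apply/matrixP => i u; rewrite !mxE !ffunE.
    by apply/matrixP => i u; rewrite !mxE !ffunE.
  move=> [[[[Pt xt] _] zt] st]; split=> //; congr (_, _, _) => //.
    apply/ffunP => u; apply/ffunP => i; rewrite !ffunE.
    by have /matrixP/(_ i u) := zt; rewrite !mxE.
  apply/ffunP => u; apply/ffunP => i; rewrite !ffunE.
  by have /matrixP/(_ i u) := xt; rewrite !mxE.
have mE v : measurable (E v).
  apply: measurableI; last by apply: (measurable_samples (V := fun u k => Z u k)) => u i.
  apply: measurableI; last by rewrite preimage_setT.
  apply: measurableI => //.
  by apply: (measurable_samples (V := fun u k => X u k)) => u i.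
have mEV v : measurable (P @^-1` B `&` V @^-1` [set v]).
  by rewrite VE; apply: measurableI => //; exact: (permutation_measurable model).
have -> : X ord0 k @^-1` [set x] `&` observation m Z Pi @^-1` [set y] `&` P @^-1` B =
    P @^-1` B `&` [set t | A (V t)].
  rewrite setIC; congr (_ `&` _); apply/seteqP; split=> t /=.
    move=> [xt yt]; apply/andP; split.
      apply/eqP; rewrite -yt; apply/matrixP => i j.
      by rewrite !mxE !ffunE.
    by rewrite !ffunE xt.
  move=> /andP[/eqP yt]; rewrite !ffunE => /eqP xt; split=> //.
  by rewrite -yt; apply/matrixP => i j; rewrite !mxE !ffunE.
rewrite (measure_finite_partition Pr A mEV); apply: eq_bigr => v _.
rewrite VE [LHS](permutation_uniform model (col_mx v.2) (col_mx v.1.2) v.1.1 mB measurableT) -/(E v).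
rewrite integralZl//; last exact: integrableS (iW v).
rewrite muleC; congr (_ * _)%E.
have [_ <-//] := is_cond_prob_channel v.2 v.1.2.
congr (Pr _); rewrite /E preimage_setT setIT [RHS]setIC.
by rewrite setIA.
Qed.

End conditional_law.

(** * Averaging over the parameters *)

Lemma measurable_invr (R : realType) : measurable_fun [set: R] (fun x : R => x^-1).
Proof.
(* At 0 the outer factor [x] makes the product vanish, in agreement with the convention for the
   inverse of 0. *)
rewrite (_ : (fun x => _) = (fun x : R => x * (x ^+ 2) `^ (-1))).
  apply: measurable_funM => //.
  apply: (measurableT_comp (measurable_powR (-1))) => //.
apply/funext => x; rewrite powR_inv1 ?sqr_ge0//.
have [->|x0] := eqVneq x 0; first by rewrite invr0 mul0r.
by field.
Qed.

Lemma measurable_mutual_information d (U : measurableType d) (R : realType)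
    (A B : finType) (q : A -> B -> U -> R) :
  (forall x y, measurable_fun [set: U] (q x y)) ->
  measurable_fun [set: U] (fun w => mutual_information (fun x y => q x y w)).
Proof.
move=> mq.
apply: measurable_sum => x; apply: measurable_sum => y.
apply: measurable_funM => //.
apply: (measurableT_comp (@measurable_ln R)).
apply: measurable_funM => //.
apply: (measurableT_comp (@measurable_invr R)).
by apply: measurable_funM; exact: measurable_sum.
Qed.

(** Two versions agree almost everywhere for each pair [(x, y)]; the pairs being finitely many, the
    integrands agree off a single null set. *)
Lemma cond_mutual_informationE d d' (T : measurableType d) (U : measurableType d')
    (R : realType) (Pr : probability T R) (A B : finType) (X : T -> A) (Y : T -> B)
    (W : {RV Pr >-> U}) (g : A -> B -> U -> R) :
  (forall x y, measurable (X @^-1` [set x] `&` Y @^-1` [set y])) ->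
  (forall x y, is_cond_prob W (X @^-1` [set x] `&` Y @^-1` [set y]) (g x y)) ->
  cond_mutual_information X Y W =
  (\int[distribution Pr W]_w (mutual_information (fun x y => g x y w))%:E)%E.
Proof.
move=> mE hg.
pose c x y := cond_prob W (X @^-1` [set x] `&` Y @^-1` [set y]).
have hc x y : is_cond_prob W (X @^-1` [set x] `&` Y @^-1` [set y]) (c x y).
  exact: cond_probP.
have mR (h : U -> R) : (distribution Pr W).-integrable setT (EFin \o h) ->
    measurable_fun setT h by move=> /measurable_int/measurable_EFinP.
have cg x y : ae_eq (distribution Pr W) setT (EFin \o c x y) (EFin \o g x y).
  have [ic ec] := hc x y; have [ig eg] := hg x y.
  apply: integral_ae_eq => //; first exact: measurable_int ig.
  by move=> B' _ mB'; rewrite -ec// -eg.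
apply: ae_eq_integral => //.
- apply/measurable_EFinP; apply: (measurable_mutual_information (q := c)) => x y.
  by apply: mR; have [] := hc x y.
- apply/measurable_EFinP; apply: measurable_mutual_information => x y.
  by apply: mR; have [] := hg x y.
have /filter_forall H : forall xy : A * B, \forall w \ae distribution Pr W,
    c xy.1 xy.2 w = g xy.1 xy.2 w.
  by case=> x y; apply: filterS (cg x y) => w /(_ Logic.I)[].
apply: filterS H => w H _; congr (_%:E).
congr mutual_information; apply/funext => x; apply/funext => y.
exact: (H (x, y)).
Qed.

(** The comparison is with [tau + \1_Bad]. Nothing bounds [h] off [D], so it is first multiplied by
    [\1_D]; in the application [D] is the cube of parameters in [0, 1]. *)
Lemma integral_le_bad d (S : measurableType d) (R : realType) (mu : probability S R)
    (h : S -> R) (D Bad : set S) (tau : R) :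
  measurable_fun [set: S] h -> measurable D -> measurable Bad ->
  mu (~` D) = 0%E -> 0 <= tau ->
  (forall w, D w -> 0 <= h w <= 1) -> (forall w, D w -> ~ Bad w -> h w <= tau) ->
  (0 <= \int[mu]_w (h w)%:E <= tau%:E + mu Bad)%E.
Proof.
move=> mh mD mBad muD tau0 h01 htau.
have mhD : measurable_fun [set: S] (fun w => h w * \1_D w).
  by apply: measurable_funM => //; exact: measurable_indic.
have -> : (\int[mu]_w (h w)%:E = \int[mu]_w (h w * \1_D w)%:E)%E.
  apply: ae_eq_integral => //; [exact/measurable_EFinP|exact/measurable_EFinP|].
  exists (~` D); split => //; first exact: measurableC.
  move=> w /= hw Dw; apply: hw => _.
  by rewrite indicE mem_set// mulr1.
have hD0 w : 0 <= h w * \1_D w.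
  rewrite indicE; have [/set_mem/h01/andP[h0 _]|_] := boolP (w \in D).
    by rewrite mulr1.
  by rewrite mulr0.
rewrite integral_ge0/=; last by move=> w _; rewrite lee_fin.
have -> : (tau%:E + mu Bad = \int[mu]_w (tau + \1_Bad w)%:E)%E.
  under eq_integral do rewrite EFinD.
  have mI : measurable_fun [set: S] (fun w => (\1_Bad w)%:E : \bar R).
    exact/measurable_EFinP/measurable_indic.
  have I0 w : setT w -> (0 <= (\1_Bad w)%:E :> \bar R)%E by rewrite lee_fin indicE.
  rewrite ge0_integralD//.
  by rewrite integral_cst// [X in (_ * X)%E]probability_setT mule1 integral_indic// setIT.
apply: ge0_le_integral => //.
- by move=> w _; rewrite lee_fin.
- exact/measurable_EFinP.
- by apply/measurable_EFinP/measurable_funD => //; exact: measurable_indic.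
move=> w _; rewrite lee_fin !indicE; have [/set_mem Dw|_] := boolP (w \in D).
  rewrite mulr1; have [_|/negP nB] := boolP (w \in Bad).
    by have /andP[_ /le_trans] := h01 _ Dw; apply; rewrite lerDr.
  by rewrite addr0 htau// => Bw; apply: nB; exact/mem_set.
by rewrite mulr0 addr_ge0.
Qed.

(** * Users close to user 1 *)

Section density.
Context {R : realType} {f : R -> R} {delta1 delta2 : R}.
Hypothesis delta1_gt0 : 0 < delta1.
Hypothesis f_continuous : {within `]0, 1[, continuous f}.
Hypothesis f_bounds : forall p : R, 0 < p < 1 -> delta1 < f p < delta2.
Hypothesis f_support : forall p : R, ~~ (0 < p < 1) -> f p = 0.
Hypothesis f_density : (\int[lebesgue_measure]_p (f p)%:E = 1)%E.
Local Notation mu := (@lebesgue_measure R).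

Lemma density_ge0 p : 0 <= f p.
Proof.
have [/f_bounds/andP[d1 _]|/f_support->//] := boolP (0 < p < 1).
by rewrite ltW// (lt_trans delta1_gt0).
Qed.

Lemma density_bound_gt0 : 0 < delta2.
Proof.
have h : (0 < 2^-1 :> R) && (2^-1 < 1 :> R) by apply/andP; split; lra.
have /andP[d1 d2] := f_bounds h.
exact: lt_trans delta1_gt0 (lt_trans d1 d2).
Qed.

Lemma measurable_density : measurable_fun [set: R] f.
Proof.
rewrite (_ : f = f \_ `]0, 1[).
  have m01 : measurable (`]0, 1[%classic : set R) by exact: measurable_itv.
  apply: (measurable_restrictT f m01).1.
  exact: subspace_continuous_measurable_fun.
apply/funext => p; rewrite patchE; case: ifPn => // /negP p01.
by rewrite f_support//; apply/negP => h; apply: p01; apply/mem_set; rewrite /= in_itv.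
Qed.

Definition mass (A : set R) : \bar R := (\int[mu]_(p in A) (f p)%:E)%E.

Let mf A : measurable_fun A (EFin \o f).
Proof. by apply/measurable_EFinP/measurable_funTS; exact: measurable_density. Qed.

Lemma mass_ge0 A : (0 <= mass A)%E.
Proof. by apply: integral_ge0 => p _; rewrite lee_fin density_ge0. Qed.

Lemma mass_le1 A : measurable A -> (mass A <= 1)%E.
Proof.
move=> mA; rewrite -f_density; apply: ge0_subset_integral => //; first exact: mf.
by move=> p _; rewrite lee_fin density_ge0.
Qed.

Lemma mass_fin A : measurable A -> mass A \is a fin_num.
Proof.
by move=> mA; rewrite ge0_fin_numE ?mass_ge0// (le_lt_trans (mass_le1 mA))// ltry.
Qed.

Lemma mass_setC A : measurable A -> mass (~` A) = (1 - mass A)%E.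
Proof.
move=> mA; have : (mass A + mass (~` A) = 1)%E.
  transitivity (mass (A `|` ~` A)); last by rewrite /mass setUv f_density.
  rewrite /mass ge0_integral_setU//.
  - exact: measurableC.
  - exact: mf.
  - by move=> p _; rewrite lee_fin density_ge0.
  - by rewrite disj_set2E setICr.
move=> <-; rewrite addeAC subee ?add0e//; exact: mass_fin.
Qed.

Lemma mass_le A : measurable A -> (mass A <= delta2%:E * mu A)%E.
Proof.
move=> mA; rewrite -integral_cst//; apply: ge0_le_integral => //.
- by move=> p _; rewrite lee_fin density_ge0.
- exact: mf.
- move=> p _; rewrite lee_fin.
  have [/f_bounds/andP[_ /ltW]//|/f_support->] := boolP (0 < p < 1).
  exact: ltW density_bound_gt0.
Qed.

Lemma mass_itv_le b0 b1 (x y : R) : x <= y ->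
  (mass [set` Interval (BSide b0 x) (BSide b1 y)] <= (delta2 * (y - x))%:E)%E.
Proof.
move=> xy; apply: le_trans (mass_le _) _; first exact: measurable_itv.
rewrite lebesgue_measure_itv/=; case: ifP => _; first by rewrite -EFinD -EFinM.
by rewrite mule0 lee_fin mulr_ge0 ?subr_ge0// ltW// density_bound_gt0.
Qed.

Lemma mass_itv_ge (x y : R) : 0 <= x -> x < y -> y <= 1 ->
  ((delta1 * (y - x))%:E <= mass `[x, y[)%E.
Proof.
(* At [x = 0] the density vanishes, so the lower bound [delta1] is applied on the open interval. *)
move=> x0 xy y1; apply: (@le_trans _ _ (mass `]x, y[)); last first.
  apply: ge0_subset_integral => //; first exact: mf.
  - by move=> p _; rewrite lee_fin density_ge0.
  - by move=> p /=; rewrite !in_itv/= => /andP[/ltW -> ->].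
have -> : ((delta1 * (y - x))%:E = \int[mu]_(p in `]x, y[) (cst delta1%:E p))%E.
  by rewrite integral_cst// [X in (_ * X)%E](lebesgue_measure_itv `]x, y[)/= lte_fin xy EFinM EFinD.
apply: ge0_le_integral => //.
- by move=> p _; rewrite lee_fin ltW.
- exact: mf.
- move=> p /=; rewrite in_itv/= => /andP[xp py]; rewrite lee_fin.
  have /f_bounds/andP[/ltW//] : 0 < p < 1.
  by rewrite (le_lt_trans x0)//= (lt_le_trans py).
Qed.

Lemma mass_outside : mass (~` `[0, 1]) = 0%E.
Proof.
apply: integral0_eq => p /=; rewrite in_itv/= => /negP p01.
congr _%:E; apply: f_support; apply: contra p01 => /andP[p0 p1].
by rewrite !ltW.
Qed.

End density.

(** Induction on [(1 - t) (1 + (N + 1) t) <= 1 + N t]. A decay in [1 / (N t)] is all that empty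
    cells require. *)
Lemma expr_onem_le (R : realType) (t : R) N : 0 <= t <= 1 ->
  (1 - t) ^+ N <= (1 + N%:R * t)^-1.
Proof.
move=> /andP[t0 t1].
have pos M : 0 < 1 + M%:R * t by rewrite ltr_pwDl// mulr_ge0.
suff : (1 - t) ^+ N * (1 + N%:R * t) <= 1 by rewrite -ler_pdivlMr// div1r.
elim: N => [|N IH]; first by rewrite expr0 mul0r addr0 mulr1.
apply: le_trans IH; rewrite exprSr -mulrA ler_wpM2l ?exprn_ge0 ?subr_ge0//.
rewrite -natr1; have : 0 <= N%:R :> R by [].
by nra.
Qed.

(** * Parameters without enough users close to user 1 *)

Section bad_parameters.
Context {R : realType} (n : nat).
Implicit Types w : (n.+1).-tuple R.

Definition cell (D c : nat) : set R := `[c%:R / D%:R, c.+1%:R / D%:R[.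

(** Taking one companion from each of several disjoint blocks makes them distinct, so it suffices to
    bound the probability that a block misses a cell; users in a cell need not be counted. The
    successor skips user 1. *)
Definition block (N b : nat) : {set 'I_n.+1} :=
  [set inord (b * N + i).+1 | i : 'I_N].

Definition lonely (N D b c : nat) : set ((n.+1).-tuple R) :=
  [set w | cell D c (tnth w ord0) /\
           forall u, u \in block N b -> ~ cell D c (tnth w u)].

(** Between the outer intervals both values of the bit have probability at least [eta]; off the
    middle one, [|1 - 2 p|] is at least [eta]. Each interval has length [eta]. *)
Definition exceptional (eta : R) : set R :=
  `[0, eta] `|` `[(1 - eta) / 2, (1 + eta) / 2] `|` `[1 - eta, 1].

(** The cell of user 1 is random; listing all cells makes every [lonely] event a box, to which
    independence applies. *)
Definition bad (eta : R) (L N D : nat) : set ((n.+1).-tuple R) :=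
  (fun w => tnth w ord0) @^-1` exceptional eta `|`
  \big[setU/set0]_(b < L) \big[setU/set0]_(c < D) lonely N D b c.

Lemma bad_mem eta L N D w : exceptional eta (tnth w ord0) \/
  (exists b c, [/\ (b < L)%N, (c < D)%N & lonely N D b c w]) -> bad eta L N D w.
Proof.
move=> [H|[b [c [bL cD H]]]]; [by left|right].
rewrite -(bigcup_mkord L (fun b => \big[setU/set0]_(c < D) lonely N D b c)); exists b => //.
by rewrite -(bigcup_mkord D (lonely N D b)); exists c.
Qed.

Lemma block_inord N L b (i : nat) : (L * N <= n)%N -> (b < L)%N -> (i < N)%N ->
  ((b * N + i).+1 < n.+1)%N.
Proof.
move=> LN bL iN; rewrite ltnS; apply: leq_trans LN.
apply: (@leq_trans (b.+1 * N)); last by rewrite leq_mul2r bL orbT.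
by rewrite mulSn addnC ltn_add2r.
Qed.

Lemma ord0_notin_block N L b : (L * N <= n)%N -> (b < L)%N ->
  ord0 \notin block N b.
Proof.
move=> LN bL; apply/negP => /imsetP[i _ /(congr1 val)/=].
by rewrite inordK// (block_inord LN bL).
Qed.

Lemma card_block N L b : (L * N <= n)%N -> (b < L)%N -> #|block N b| = N.
Proof.
move=> LN bL; rewrite card_imset ?card_ord// => i j /(congr1 val)/=.
by rewrite !inordK ?(block_inord LN bL)// => -[/addnI/val_inj].
Qed.

Lemma block_inj N L b b' u : (L * N <= n)%N -> (b < L)%N -> (b' < L)%N ->
  u \in block N b -> u \in block N b' -> b = b'.
Proof.
move=> LN bL bL' /imsetP[i _ ->] /imsetP[j _ /(congr1 val)/=].
have N0 : (0 < N)%N by case: N i {LN j} => [[]|].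
rewrite !inordK ?(block_inord LN)// => -[/(congr1 (divn^~ N))].
by rewrite !divnMDl// !divn_small// !addn0.
Qed.

Lemma not_bad eta L N D w : (0 < D)%N -> 0 < eta -> (L * N <= n)%N ->
  (forall u, 0 <= tnth w u <= 1) -> ~ bad eta L N D w ->
  [/\ eta <= tnth w ord0 <= 1 - eta, eta <= `|1 - 2 * tnth w ord0| &
    exists J : {set 'I_n.+1}, [/\ #|J| = L.+1, ord0 \in J &
      forall j, j \in J -> `|tnth w ord0 - tnth w j| <= D%:R^-1]].
Proof.
move=> D0 eta0 LN w01 /(contra_not (@bad_mem _ _ _ _ _))/not_orP[nE nL].
have /andP[w0 w1] := w01 ord0.
have D0' : 0 < D%:R :> R by rewrite ltr0n.
move/not_orP : nE => [/not_orP[/= +] +]; rewrite /= !in_itv/= => /negP + /negP + /negP.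
rewrite w0 w1 andbT/= -!ltNge negb_and -!ltNge => wl wm wr.
split.
- by apply/andP; split; lra.
- by rewrite ler_normr; apply/orP; case/orP: wm => wm; [left|right]; lra.
set c := Num.trunc (tnth w ord0 * D%:R).
have cP : cell D c (tnth w ord0).
  rewrite /cell /= in_itv/= ler_pdivrMr// ltr_pdivlMr//.
  by apply: truncn_itv; rewrite mulr_ge0.
(* The parameter 1 would fall in the cell of index [D]; it has been excluded by [exceptional]. *)
have cD : (c < D)%N.
  rewrite -(ltr_nat R) -(mul1r D%:R) -ltr_pdivrMr//.
  have := cP; rewrite /cell /= in_itv/= => /andP[/le_lt_trans + _]; apply.
  lra.
have mate (b : 'I_L) : exists u, u \in block N b /\ cell D c (tnth w u).
  apply: contrapT => /forallNP h; apply: nL.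
  exists (val b), c; split; [exact: ltn_ord|by []|].
  by split=> // u ub cu; apply: (h u).
have [j hj] := choice mate.
(* User 1 and one companion per block, distinct because the blocks are disjoint. *)
exists (ord0 |: [set j b | b : 'I_L]); split.
- rewrite cardsU1 card_imset ?card_ord; last first.
    move=> b b' jj; have h1 := (hj b).1; have h2 := (hj b').1.
    rewrite -jj in h2; apply/val_inj.
    exact: (block_inj LN (ltn_ord b) (ltn_ord b') h1 h2).
  rewrite (_ : ord0 \notin _)//; apply/imsetP => -[b _ j0].
  by have /negP := ord0_notin_block LN (ltn_ord b); apply; rewrite j0; exact: (hj b).1.
- by rewrite setU11.
move=> u; rewrite in_setU1 => /orP[/eqP->|/imsetP[b _ ->]].
  by rewrite subrr normr0 invr_ge0 ltW.
have := (hj b).2; have := cP; rewrite /cell /= !in_itv/= -natr1 mulrDl div1r.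
move=> /andP[c1 c2] /andP[c3 c4].
by rewrite ler_norml; apply/andP; split; lra.
Qed.

End bad_parameters.

Section prob_bad.
Context d (T : measurableType d) (R : realType) (Pr : probability T R).
Variables (n : nat) (f : R -> R) (a delta1 delta2 : R).
Variables (P : {RV Pr >-> (n.+1).-tuple R}).
Variables (X : 'I_n.+1 -> nat -> {RV Pr >-> bool}).
Variables (N : {RV Pr >-> (n.+1).-tuple R}).
Variables (Z : 'I_n.+1 -> nat -> {RV Pr >-> bool}).
Variable Pi : T -> 'S_n.+1.
Hypothesis model : two_states_model f a P X N Z Pi.
Hypothesis delta1_gt0 : 0 < delta1.
Hypothesis f_continuous : {within `]0, 1[, continuous f}.
Hypothesis f_bounds : forall p : R, 0 < p < 1 -> delta1 < f p < delta2.
Hypothesis f_support : forall p : R, ~~ (0 < p < 1) -> f p = 0.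
Hypothesis f_density : (\int[lebesgue_measure]_p (f p)%:E = 1)%E.
Local Notation mass := (mass (f := f)).
Local Notation law := (distribution Pr P).

Let mass_fin' A := @mass_fin R f delta1 delta2 delta1_gt0 f_continuous f_bounds
  f_support f_density A.
Let mass_setC' A := @mass_setC R f delta1 delta2 delta1_gt0 f_continuous f_bounds
  f_support f_density A.
Let massT : mass setT = 1%E. Proof. exact: f_density. Qed.
Let d2_ge0 : 0 <= delta2.
Proof. exact: ltW (density_bound_gt0 delta1_gt0 f_bounds). Qed.

Lemma law_box (C : 'I_n.+1 -> set R) : (forall u, measurable (C u)) ->
  law [set w | forall u, C u (tnth w u)] = (\prod_u mass (C u))%E.
Proof. exact: (parameters_iid model). Qed.

Lemma law_outside : law (~` [set w | forall u, 0 <= tnth w u <= 1]) = 0%E.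
Proof.
have mI : measurable (`[0, 1]%classic : set R) by exact: measurable_itv.
have -> : [set w : (n.+1).-tuple R | forall u, 0 <= tnth w u <= 1] =
    [set w | forall u, `[0, 1]%classic (tnth w u)].
  by apply/seteqP; split=> w /= H u; have := H u; rewrite in_itv.
rewrite probability_setC; last exact: (measurable_tnth_forall (C := fun=> `[0, 1]%classic)).
rewrite [X in (_ - X)%E](law_box (C := fun=> `[0, 1]%classic))// big1 ?subee// => u _.
rewrite -(setCK `[0, 1]%classic) mass_setC'; last exact: measurableC.
by rewrite (mass_outside f_support) sube0.
Qed.

Lemma law_first A : measurable A -> law ((fun w => tnth w ord0) @^-1` A) = mass A.
Proof.
move=> mA; pose C (u : 'I_n.+1) := if u == ord0 then A else setT.
rewrite (_ : _ @^-1` A = [set w | forall u, C u (tnth w u)]).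
  rewrite law_box => [|u]; last by rewrite /C; case: ifP.
  rewrite (bigD1 ord0)//= big1 ?mule1 => [|u /negbTE u0]; rewrite /C ?eqxx//.
  by rewrite u0 massT.
apply/seteqP; split=> w /=.
  by move=> Aw u; rewrite /C; case: eqP => [->|].
by move=> /(_ ord0).
Qed.

(** The box has mass [r (1 - r) ^+ Nb], with [r] the mass of the cell. The upper bound on [r] serves
    for user 1, so that the sum over the [D] cells stays bounded; the lower bound serves for the
    users missing the cell. *)
Lemma law_lonely Nb D b c L : (0 < D)%N -> (c < D)%N -> (L * Nb <= n)%N -> (b < L)%N ->
  (law (lonely Nb D b c) <= (delta2 / D%:R * (1 - delta1 / D%:R) ^+ Nb)%:E)%E.
Proof.
move=> D0 cD LN bL.
have D0' : 0 < D%:R :> R by rewrite ltr0n.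
have mcell : measurable (cell D c : set R) by exact: measurable_itv.
pose C (u : 'I_n.+1) : set R := if u == ord0 then cell D c else
  if u \in block n Nb b then ~` cell D c else setT.
have mC u : measurable (C u).
  by rewrite /C; case: ifP => _ //; case: ifP => _ //; exact: measurableC.
have b0 := ord0_notin_block LN bL.
have -> : lonely Nb D b c = [set w | forall u, C u (tnth w u)].
  apply/seteqP; split=> w /=.
    move=> [w0 wb] u; rewrite /C; case: eqP => [->//|_].
    by case: ifP => // /wb.
  move=> H; split=> [|u ub]; first by have := H ord0; rewrite /C eqxx.
  have := H u; rewrite /C ub; case: eqP => // u0.
  by move: b0; rewrite -u0 ub.
rewrite law_box//.
pose r := fine (mass (cell D c)).
have rE : mass (cell D c) = r%:E by rewrite fineK// mass_fin'.
have itvD : c.+1%:R / D%:R - c%:R / D%:R = D%:R^-1 :> R.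
  by rewrite -natr1 mulrDl addrAC subrr add0r div1r.
have r_le : r <= delta2 / D%:R.
  rewrite -lee_fin -rE -itvD.
  apply: (mass_itv_le delta1_gt0 f_continuous f_bounds f_support).
  by rewrite ler_pM2r ?invr_gt0// ler_nat.
have r_ge : delta1 / D%:R <= r.
  rewrite -lee_fin -rE -itvD.
  apply: (mass_itv_ge delta1_gt0 f_continuous f_bounds f_support).
  - by rewrite divr_ge0.
  - by rewrite ltr_pM2r ?invr_gt0// ltr_nat.
  - by rewrite ler_pdivrMr// mul1r ler_nat.
have r_le1 : r <= 1.
  by rewrite -lee_fin -rE; exact: (mass_le1 delta1_gt0 f_continuous f_bounds f_support f_density).
have r0 : 0 <= r by rewrite (le_trans _ r_ge)// divr_ge0// ltW.
have -> : (\prod_u mass (C u) = (r * (1 - r) ^+ Nb)%:E)%E.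
  rewrite (eq_bigr (fun u => (if u == ord0 then r else
      if u \in block n Nb b then 1 - r else 1)%:E)).
    rewrite prodEFin; congr _%:E; rewrite (bigD1 ord0)//=; congr (_ * _).
    rewrite -[X in _ = _ ^+ X](card_block LN bL) -prodr_const [RHS]big_mkcond/=.
    rewrite [RHS](bigD1 ord0)//= (negbTE b0) mul1r.
    by apply: eq_bigr => u /negbTE ->.
  move=> u _; rewrite /C; case: eqP => // _; case: ifP => // _.
  by rewrite mass_setC'// rE -EFinB.
rewrite lee_fin ler_pM ?exprn_ge0 ?subr_ge0// lerXn2r ?nnegrE ?subr_ge0//.
  exact: le_trans r_le1.
by rewrite lerD2l lerN2.
Qed.

Let mt u (A : set R) : measurable A ->
  measurable ((fun w : (n.+1).-tuple R => tnth w u) @^-1` A).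
Proof. by move=> mA; have := measurable_tnth u measurableT mA; rewrite setTI. Qed.

Lemma measurable_lonely Nb D b c : measurable (@lonely R n Nb D b c).
Proof.
have mcell : measurable (cell D c : set R) by exact: measurable_itv.
apply: measurableI; first exact: mt.
apply: measurable_forall => u.
have [ub|ub] := boolP (u \in block n Nb b).
  rewrite (_ : (fun _ => _) = (fun w : (n.+1).-tuple R => tnth w u) @^-1` (~` cell D c)).
    by apply: mt; exact: measurableC.
  by apply/seteqP; split=> w /= H; [exact: H|move=> _].
rewrite (_ : (fun _ => _) = setT)//.
by apply/seteqP; split=> w //= _.
Qed.

Lemma measurable_exceptional (eta : R) : measurable (exceptional eta).
Proof. by apply: measurableU; [apply: measurableU|]; exact: measurable_itv. Qed.

Let measurable_first_exceptional (eta : R) :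
  measurable ((fun w : (n.+1).-tuple R => tnth w ord0) @^-1` exceptional eta).
Proof. by apply: mt; exact: measurable_exceptional. Qed.

Lemma measurable_bad (eta : R) L Nb D : measurable (@bad R n eta L Nb D).
Proof.
apply: measurableU => //.
apply: bigsetU_measurable => b _; apply: bigsetU_measurable => c _.
exact: measurable_lonely.
Qed.

Lemma law_bad_le (eta : R) L Nb D : (0 < D)%N -> 0 < eta -> (L * Nb <= n)%N ->
  (law (bad eta L Nb D) <=
   (3 * eta * delta2 + L%:R * delta2 * (1 - delta1 / D%:R) ^+ Nb)%:E)%E.
Proof.
move=> D0 eta0 LN.
have D0' : 0 < D%:R :> R by rewrite ltr0n.
apply: le_trans (measureU2 _ _ _) _ => //.
  apply: bigsetU_measurable => b _; apply: bigsetU_measurable => c _.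
  exact: measurable_lonely.
rewrite EFinD leeD//.
  rewrite [X in (X <= _)%E]law_first; last exact: measurable_exceptional.
  have mle (x y : R) : x <= y -> (mass `[x, y] <= (delta2 * (y - x))%:E)%E.
    exact: (mass_itv_le delta1_gt0 f_continuous f_bounds f_support).
  have mU A B : measurable A -> measurable B -> (mass (A `|` B) <= mass A + mass B)%E.
    move=> mA mB; rewrite -!law_first//; last exact: measurableU.
    exact: (measureU2 law (mt ord0 mA) (mt ord0 mB)).
  have mI (x y : R) : measurable (`[x, y]%classic : set R) by exact: measurable_itv.
  apply: (@le_trans _ _ ((delta2 * (eta - 0)) +
      (delta2 * ((1 + eta) / 2 - (1 - eta) / 2)) + (delta2 * (1 - (1 - eta))))%:E).
    rewrite !EFinD; apply: le_trans (mU _ _ _ _) _ => //; first exact: measurableU.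
    apply: leeD; last by apply: mle; lra.
    apply: le_trans (mU _ _ _ _) _ => //.
    by apply: leeD; apply: mle; lra.
  by rewrite lee_fin; lra.
have BL := @Boole_inequality _ _ _ law
  (fun b => \big[setU/set0]_(c < D) lonely Nb D b c) L.
apply: le_trans (BL _) _.
  by move=> b _; apply: bigsetU_measurable => c _; exact: measurable_lonely.
apply: (@le_trans _ _ (\sum_(b < L) (delta2 * (1 - delta1 / D%:R) ^+ Nb)%:E)%E).
  apply: lee_sum => b _.
  have BD := @Boole_inequality _ _ _ law (lonely Nb D b) D.
  apply: le_trans (BD _) _.
    by move=> c _; exact: measurable_lonely.
  apply: (@le_trans _ _
      (\sum_(c < D) (delta2 / D%:R * (1 - delta1 / D%:R) ^+ Nb)%:E)%E).
    by apply: lee_sum => c _; apply: (law_lonely D0 (ltn_ord c) LN (ltn_ord b)).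
  rewrite sumEFin sumr_const card_ord lee_fin -[leLHS]mulr_natl.
  by rewrite le_eqVlt; apply/orP; left; apply/eqP; field; rewrite gt_eqF.
by rewrite sumEFin sumr_const card_ord lee_fin -[leLHS]mulr_natl mulrA.
Qed.

End prob_bad.

(** * Limit *)

Section model_bound.
Context d (T : measurableType d) (R : realType) (Pr : probability T R).
Variables (n : nat) (f : R -> R) (a delta1 delta2 : R).
Variables (P : {RV Pr >-> (n.+1).-tuple R}).
Variables (X : 'I_n.+1 -> nat -> {RV Pr >-> bool}).
Variables (N : {RV Pr >-> (n.+1).-tuple R}).
Variables (Z : 'I_n.+1 -> nat -> {RV Pr >-> bool}).
Variable Pi : T -> 'S_n.+1.
Hypothesis model : two_states_model f a P X N Z Pi.
Hypothesis a01 : 0 < a <= 1.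
Hypothesis delta1_gt0 : 0 < delta1.
Hypothesis f_continuous : {within `]0, 1[, continuous f}.
Hypothesis f_bounds : forall p : R, 0 < p < 1 -> delta1 < f p < delta2.
Hypothesis f_support : forall p : R, ~~ (0 < p < 1) -> f p = 0.
Hypothesis f_density : (\int[lebesgue_measure]_p (f p)%:E = 1)%E.

Lemma measurable_observation m (y : 'M[bool]_(m, n.+1)) :
  measurable (observation m Z Pi @^-1` [set y]).
Proof.
have mS (s : 'S_n.+1) (i : 'I_m) (j : 'I_n.+1) :
    measurable (Z (s^-1%g j) i @^-1` [set y i j]) by exact: measurable_funPTI.
rewrite (_ : _ @^-1` _ = \big[setU/set0]_(s : 'S_n.+1) (Pi @^-1` [set s] `&`
    [set t | forall ij : 'I_m * 'I_n.+1, Z (s^-1%g ij.2) ij.1 t = y ij.1 ij.2])).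
  apply: bigsetU_measurable => s _.
  apply: measurableI; first exact: (permutation_measurable model).
  by apply: measurable_forall => -[i j]; exact: mS.
rewrite -bigcup_seq; apply/seteqP; split=> t /=.
  move=> yt; exists (Pi t) => /=; first exact: mem_index_enum.
  by split=> // -[i j]/=; rewrite -yt mxE.
by move=> [s _ [/= sE H]]; apply/matrixP => i j; rewrite mxE sE (H (i, j)).
Qed.

(** The first term bounds the mutual information off [bad], the second the probability of [bad]. *)
Lemma cond_mutual_information_le (m k L Nb D : nat) (eps eta gam : R) :
  (0 < D)%N -> 0 < eta -> 0 < gam -> 0 < eps -> (L * Nb <= n)%N -> D%:R^-1 <= eps * a ->
  (0 <= cond_mutual_information (X ord0 k) (observation m Z Pi) P <=
   (2 / eta * (a + L.+1%:R * (4 * eps / eta) +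
               (gam + (L.+1%:R^-1 + a ^+ 2) / gam)))%:E +
   (3 * eta * delta2 + L%:R * delta2 * (1 - delta1 / D%:R) ^+ Nb)%:E)%E.
Proof.
move=> D0 eta0 gam0 eps0 LN Deps.
have [a0 _] := andP a01.
pose g x y (w : (n.+1).-tuple R) :=
  joint_law (@visible n m k) (Ordinal (time_lt m k)) a (tnth w) x y.
have hg x y : is_cond_prob P
    (X ord0 k @^-1` [set x] `&` observation m Z Pi @^-1` [set y]) (g x y).
  exact: (is_cond_prob_joint_law model a01).
rewrite (cond_mutual_informationE _ hg); last first.
  by move=> x y; apply: measurableI; [exact: measurable_funPTI|
    exact: measurable_observation].
set tau := 2 / eta * _.
have tau0 : 0 <= tau.
  rewrite mulr_ge0 ?divr_ge0 ?(ltW eta0)// !addr_ge0 ?(ltW a0) ?(ltW gam0)//.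
    by rewrite mulr_ge0// divr_ge0 ?(ltW eta0)// mulr_ge0// ltW.
  by rewrite divr_ge0 ?(ltW gam0)// addr_ge0 ?invr_ge0// sqr_ge0.
pose I := [set w : (n.+1).-tuple R | forall u, 0 <= tnth w u <= 1].
have mI : measurable I.
  apply: (measurable_tnth_forall (C := fun=> [set x | 0 <= x <= 1])) => u.
  rewrite (_ : [set x | _] = `[0, 1]%classic); first exact: measurable_itv.
  by apply/seteqP; split=> x /=; rewrite in_itv.
have mh : measurable_fun [set: (n.+1).-tuple R]
    (fun w => mutual_information (fun x y => g x y w)).
  apply: measurable_mutual_information => x y.
  by have [/measurable_int/measurable_EFinP] := hg x y.
have hI w : I w -> 0 <= mutual_information (fun x y => g x y w) <= 1.
  by move=> hw; exact: mutual_information_joint_law_bounds.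
have hbad w : I w -> ~ bad eta L Nb D w -> mutual_information (fun x y => g x y w) <= tau.
  move=> hw /(not_bad D0 eta0 LN hw)[w0 w0' [J [cJ J0 hJ]]].
  rewrite /tau -cJ; apply: mutual_information_joint_law_le => // j jJ.
  exact: le_trans (hJ j jJ) Deps.
have nullI := law_outside model delta1_gt0 f_continuous f_bounds f_support f_density.
have /andP[-> /le_trans le] := integral_le_bad (mu := distribution Pr P)
  mh mI (@measurable_bad R n eta L Nb D) nullI tau0 hI hbad.
apply: le; rewrite leeD2l//.
exact: (law_bad_le model delta1_gt0 f_continuous f_bounds f_support f_density).
Qed.

End model_bound.

Lemma near_powR_ge (R : realType) (b M : R) : 0 < b ->
  \forall n \near \oo, M <= n.+1%:R `^ b.
Proof.
move=> b0; have [M0|M0] := leP M 0.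
  by apply: nearW => n; apply: le_trans M0 (powR_ge0 _ _).
near=> n.
have -> : M = (M `^ b^-1) `^ b by rewrite -powRrM mulVf ?gt_eqF// powRr1// ltW.
apply: ge0_ler_powR; rewrite ?nnegrE ?powR_ge0//; first exact: ltW.
apply: le_trans (_ : n%:R <= _); last by rewrite ler_nat.
by near: n; exact: nbhs_infty_ger.
Unshelve. all: by end_near. Qed.

Section noise.
Context {R : realType} {c beta : R}.
Hypothesis c_gt0 : 0 < c.
Hypothesis beta_lt1 : beta < 1.

Lemma noise_level_gt0 n : 0 < noise_level c beta n.+1.
Proof. by rewrite mulr_gt0// powR_gt0. Qed.

Lemma noise_level_mul n :
  n.+1%:R * noise_level c beta n.+1 = c * n.+1%:R `^ beta.
Proof.
rewrite /noise_level mulrCA; congr (_ * _).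
have n0 : n.+1%:R != 0 :> R by rewrite pnatr_eq0.
rewrite -{1}(@powRr1 _ n.+1%:R)// -powRD ?n0 ?implybT//.
by congr (_ `^ _); ring.
Qed.

Lemma near_noise_level_le e : 0 < e -> \forall n \near \oo, noise_level c beta n.+1 <= e.
Proof.
move=> e0; have b1 : 0 < 1 - beta by rewrite subr_gt0.
have := near_powR_ge (c / e) b1; apply: filterS => n.
rewrite /noise_level powRN.
have p0 : 0 < n.+1%:R `^ (1 - beta) by rewrite powR_gt0.
by rewrite ler_pdivrMr// mulrC -ler_pdivrMr.
Qed.

End noise.

Lemma near_empty_cells_le (R : realType) (delta1 delta2 c beta eps tau : R) (L : nat) :
  0 < delta1 <= 1 -> 0 <= delta2 -> 0 < c -> 0 < beta -> beta < 1 ->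
  0 < eps <= 1 -> 0 < tau ->
  \forall n \near \oo, forall D,
    D%:R <= (eps * noise_level c beta n.+1)^-1 + 1 -> (0 < D)%N ->
    L%:R * delta2 * (1 - delta1 / D%:R) ^+ (n %/ L.+1) <= tau.
Proof.
move=> /andP[d10 d11] d20 c0 beta0 beta1 /andP[e0 e1] tau0.
(* By [expr_onem_le] it suffices that [Q <= Nb t] with [t = delta1 / D]. Since [D <= 2 / (eps a)],
   this follows from [M <= Nb a]. *)
pose Q := (L%:R * delta2 + 1) / tau.
have Q0 : 0 < Q by rewrite divr_gt0// ltr_wpDl// mulr_ge0.
pose M := Q * 2 / (delta1 * eps).
have M0 : 0 < M by rewrite divr_gt0// mulr_gt0.
near=> n.
have a1 : noise_level c beta n.+1 <= 1 by near: n; exact: near_noise_level_le.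
(* The margin over [M] absorbs the rounding in [n %/ L.+1], which costs at most [a <= 1]. *)
have na : L.+1%:R * (M + 2) <= n.+1%:R * noise_level c beta n.+1.
  rewrite noise_level_mul// -ler_pdivrMl//.
  by near: n; exact: near_powR_ge.
set a := noise_level c beta n.+1 in a1 na *.
have a0 : 0 < a by exact: noise_level_gt0.
move=> D DD D0; set Nb := (n %/ L.+1)%N.
have D0' : 0 < D%:R :> R by rewrite ltr0n.
have D1 : 1 <= D%:R :> R by rewrite ler1n.
have Nba : M <= Nb%:R * a.
  have : n.+1%:R <= (Nb%:R + 1) * L.+1%:R :> R.
    by rewrite natr1 -natrM ler_nat ltn_ceil.
  rewrite -(ler_pM2r a0) => /(le_trans na); rewrite mulrAC mulrC ler_pM2r ?ltr0n//.
  by rewrite mulrDl mul1r; lra.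
have t_ge : delta1 * (eps * a) / 2 <= delta1 / D%:R.
  have ea0 : 0 < eps * a by rewrite mulr_gt0.
  have ea1 : eps * a <= 1 by rewrite mulr_ile1// ltW.
  have h : eps * a * D%:R <= 2.
    have := DD; rewrite -(ler_pM2l ea0) mulrDr divff ?gt_eqF// mulr1; lra.
  by rewrite ler_pdivlMr//; have := ler_wpM2l (ltW d10) h; lra.
have Nt : Q <= Nb%:R * (delta1 / D%:R).
  apply: (@le_trans _ _ (Nb%:R * (delta1 * (eps * a) / 2))); last by rewrite ler_wpM2l.
  rewrite (_ : _ * (_ / 2) = Nb%:R * a * (delta1 * eps / 2)); last by field.
  apply: (@le_trans _ _ (M * (delta1 * eps / 2))); last first.
    by rewrite ler_wpM2r// divr_ge0// mulr_ge0// ltW.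
  by rewrite le_eqVlt; apply/orP; left; apply/eqP; rewrite /M; field; rewrite !gt_eqF.
have t01 : 0 <= delta1 / D%:R <= 1.
  rewrite divr_ge0 ?(ltW d10)//= ler_pdivrMr// mul1r.
  exact: le_trans d11 D1.
have Ld : 0 < L%:R * delta2 + 1 by rewrite ltr_wpDl// mulr_ge0.
apply: (@le_trans _ _ ((L%:R * delta2 + 1) * Q^-1)).
  apply: ler_pM; rewrite ?mulr_ge0 ?exprn_ge0 ?subr_ge0 ?lerDl//; first by case/andP: t01.
  apply: le_trans (expr_onem_le _ t01) _.
  rewrite lef_pV2 ?posrE// ?ltr_pwDl//; last by rewrite mulr_ge0//; case/andP: t01.
  by apply: (le_trans Nt); rewrite lerDr.
by rewrite /Q invf_div mulrC divfK// gt_eqF.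
Unshelve. all: by end_near. Qed.

(* The n-th model has n.+1 users, so that user 1 (here ord0) exists. *)
Theorem theorem1 (R : realType) (f : R -> R) (delta1 delta2 : R)
    (c beta : R) (m : nat -> nat)
    (delta1_gt0 : 0 < delta1) (delta2_gt0 : 0 < delta2)
    (f_continuous : {within `]0, 1[, continuous f})
    (f_bounds : forall p : R, 0 < p < 1 -> delta1 < f p < delta2)
    (f_support : forall p : R, ~~ (0 < p < 1) -> f p = 0)
    (f_density : (\int[lebesgue_measure]_p (f p)%:E = 1)%E)
    (c_gt0 : 0 < c) (beta_gt0 : 0 < beta) (beta_lt1 : beta < 1)
    (d : nat -> measure_display) (T : forall n : nat, measurableType (d n))
    (Pr : forall n : nat, probability (T n) R)
    (P : forall n : nat, {RV (Pr n) >-> (n.+1).-tuple R})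
    (X : forall n : nat, 'I_n.+1 -> nat -> {RV (Pr n) >-> bool})
    (N : forall n : nat, {RV (Pr n) >-> (n.+1).-tuple R})
    (Z : forall n : nat, 'I_n.+1 -> nat -> {RV (Pr n) >-> bool})
    (Pi : forall n : nat, T n -> 'S_n.+1)
    (model : forall n : nat, noise_level c beta n.+1 <= 1 ->
       two_states_model f (noise_level c beta n.+1)
         (P n) (X n) (N n) (Z n) (Pi n)) :
  forall k : nat,
    (fun n : nat =>
       cond_mutual_information (X n ord0 k)
         (observation (m n.+1) (Z n) (Pi n)) (P n)) @ \oo --> 0%E.
Proof.
move=> k; set I := fun n => _.
(* Used with [g = tau ^+ 2], the common scale of the four error terms. *)
have sum5 (x y g : R) : x <= g -> y <= 2 * g -> x + g + (g + y) <= 5 * g by lra.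
suff H e : 0 < e -> \forall n \near \oo, (0 <= I n <= e%:E)%E.
  apply/fine_cvgP; split.
    apply: filterS (H 1 ltr01) => n /andP[I0 I1].
    by rewrite ge0_fin_numE// (le_lt_trans I1)// ltry.
  apply/cvgrPdist_le => e e0; apply: filterS (H e e0) => n /andP[I0 I1].
  have If : I n \is a fin_num by rewrite ge0_fin_numE// (le_lt_trans I1)// ltry.
  by rewrite sub0r normrN ger0_norm ?fine_ge0// -lee_fin fineK.
move=> e0.
(* Good parameters contribute [10 tau], [exceptional] ones [3 delta2 tau], and [lonely] ones
   [tau]. *)
pose C := 11 + 3 * delta2.
have C0 : 0 < C by rewrite addr_gt0// mulr_gt0.
pose tau := Num.min 1 (e / C).
have tau0 : 0 < tau by rewrite lt_min ltr01 divr_gt0.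
have tau1 : tau <= 1 by rewrite ge_min lexx.
have Ctau : C * tau <= e by rewrite mulrC -ler_pdivlMr// ge_min lexx orbT.
(* With [eta = tau] and [gam = tau ^+ 2], every error must be of order [tau ^+ 2] to survive the
   factor [2 / eta]. This dictates [L], then [eps], both independent of [n], and finally
   [a <= tau ^+ 2]. *)
pose L := Num.trunc (tau ^- 4).
have L_gt : L.+1%:R^-1 <= tau ^+ 4.
  have /andP[_] : L%:R <= tau ^- 4 < L.+1%:R.
    by apply: truncn_itv; rewrite invr_ge0 exprn_ge0// ltW.
  move=> /ltW; rewrite -[in X in _ -> X](invrK (tau ^+ 4)).
  by rewrite lef_pV2// ?posrE ?invr_gt0 ?exprn_gt0.
have L0 : 0 < L.+1%:R :> R by [].
pose eps := tau ^+ 3 / (4 * L.+1%:R).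
have eps0 : 0 < eps by rewrite divr_gt0 ?exprn_gt0// mulr_gt0.
have eps1 : eps <= 1.
  rewrite ler_pdivrMr ?mulr_gt0// mul1r (le_trans (exprn_ile1 3 (ltW tau0) tau1))//.
  by rewrite -natrM ler1n.
have d11 : delta1 <= 1.
  have := mass_itv_ge delta1_gt0 f_continuous f_bounds f_support (lexx 0) ltr01 (lexx 1).
  rewrite subr0 mulr1 -lee_fin => /le_trans; apply.
  exact: (mass_le1 delta1_gt0 f_continuous f_bounds f_support f_density).
near=> n.
have a_tau : noise_level c beta n.+1 <= tau ^+ 2.
  by near: n; apply: near_noise_level_le => //; exact: exprn_gt0.
have empty : forall D, D%:R <= (eps * noise_level c beta n.+1)^-1 + 1 ->
    (0 < D)%N -> L%:R * delta2 * (1 - delta1 / D%:R) ^+ (n %/ L.+1) <= tau.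
  near: n; apply: near_empty_cells_le => //; rewrite ?delta1_gt0 ?d11 ?eps0 ?eps1//.
  exact: ltW.
set a := noise_level c beta n.+1 in a_tau empty *.
have a0 : 0 < a by exact: noise_level_gt0.
have a1 : a <= 1 by rewrite (le_trans a_tau)// exprn_ile1// ltW.
(* Above [1 / (eps a)], so that users in one cell are close enough, but by at most 1, so that the
   cells are wide enough to be hit. *)
pose D := (Num.trunc (eps * a)^-1).+1.
have ea0 : 0 < eps * a by rewrite mulr_gt0.
have /andP[D_le D_gt] : (Num.trunc (eps * a)^-1)%:R <= (eps * a)^-1 < D%:R.
  by apply: truncn_itv; rewrite invr_ge0 ltW.
have Deps : D%:R^-1 <= eps * a.
  by rewrite -[leRHS]invrK lef_pV2 ?posrE ?invr_gt0// ltW.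
have cells : L%:R * delta2 * (1 - delta1 / D%:R) ^+ (n %/ L.+1) <= tau.
  by apply: empty => //; rewrite /D -natr1 lerD2r.
have LN : (L * (n %/ L.+1) <= n)%N.
  by apply: leq_trans (leq_trunc_div n L.+1); rewrite mulnC leq_mul2l leqnSn orbT.
have a01 : 0 < a <= 1 by rewrite a0.
have gam0 : 0 < tau ^+ 2 by rewrite exprn_gt0.
have /andP[-> /le_trans] := cond_mutual_information_le (model n a1) a01 delta1_gt0
  f_continuous f_bounds f_support f_density (m n.+1) k (D := D) (ltn0Sn _) tau0 gam0
  eps0 LN Deps.
apply; rewrite -EFinD lee_fin; apply: le_trans Ctau.
have h1 : L.+1%:R * (4 * eps / tau) = tau ^+ 2.
  by rewrite /eps; field; rewrite !gt_eqF.
have h2 : (L.+1%:R^-1 + a ^+ 2) / tau ^+ 2 <= 2 * tau ^+ 2.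
  rewrite ler_pdivrMr// (_ : 2 * _ * _ = 2 * tau ^+ 4); last by ring.
  have : a ^+ 2 <= tau ^+ 4.
    by rewrite (exprM tau 2 2) lerXn2r ?nnegrE// ltW.
  by move=> a4; rewrite mulrDl mul1r lerD.
have h3 : 2 / tau * (a + L.+1%:R * (4 * eps / tau) +
    (tau ^+ 2 + (L.+1%:R^-1 + a ^+ 2) / tau ^+ 2)) <= 10 * tau.
  rewrite (_ : 10 * tau = 2 / tau * (5 * tau ^+ 2)); last by field; rewrite gt_eqF.
  by rewrite ler_wpM2l ?divr_ge0 ?(ltW tau0)// h1 sum5.
apply: (@le_trans _ _ (10 * tau + (3 * tau * delta2 + tau))).
  by rewrite lerD// lerD2l.
by rewrite le_eqVlt; apply/orP; left; apply/eqP; rewrite /C; ring.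
Unshelve. all: by end_near. Qed.
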